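(* There exists a universal constant $c$ such that the following holds. Let $n\ge 2$, $d\ge1$, $M\ge 1$ be integers, let $\alpha\in(0,1]$, and let $\mathbb{R}^d=\mathcal{X}_1\cup\dots\cup\mathcal{X}_M$ be a fixed partition. Let $\widehat{C}_n$ be the confidence interval $\widehat{C}_n(x)=C_{\tilde{\boldsymbol\pi},\tilde{\mathbf a}}(x)$ constructed (as specified in the context) from the training data $(X_1,Y_1),\dots,(X_n,Y_n)$. Then $\widehat{C}_n$ provides a $(1-\alpha)$-distribution-free confidence interval for binary regression. Furthermore, for all distributions $P$ on $\mathbb{R}^d\times\{0,1\}$, with $(X_1,Y_1),\dots,(X_{n+1},Y_{n+1})$ drawn i.i.d. from $P$, \[\mathbb{E}\left[\mathrm{leb}(\widehat{C}_n(X_{n+1}))\right]\le L_\alpha(\Pi_P)+\sqrt{\frac{2\Delta_P(\mathcal{X}_{1:M})}{\alpha}}+c\sqrt{\frac{M\log n}{\alpha n}}.\]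
   Context: For a distribution $P$ on $(X,Y)\in\mathbb{R}^d\times\{0,1\}$, $P_X$ is the marginal of $X$, $\pi_P(x)=\mathbb{P}_P\{Y=1\mid X=x\}$, and $\Pi_P$ is the distribution of $\pi_P(X)$ on $[0,1]$. $\mathrm{leb}$ is Lebesgue measure on $\mathbb{R}$; $\log$ is the natural logarithm. A (possibly randomized) algorithm $\widehat{C}_n$, mapping training data $(X_i,Y_i)_{i\le n}$ and a point $x$ to a set $\widehat{C}_n(x)\subseteq\mathbb{R}$, provides a $(1-\alpha)$-distribution-free confidence interval for binary regression if, for all distributions $P$ on $\mathbb{R}^d\times\{0,1\}$, with $(X_i,Y_i)$, $i=1,\dots,n+1$, i.i.d. from $P$, $\mathbb{P}\{\pi_P(X_{n+1})\in\widehat{C}_n(X_{n+1})\}\ge1-\alpha$. Probabilities and expectations are also taken over any additional independent randomness used by the algorithm. The function $\ell$: for $t\in[0,\frac12]$, $a\in[0,1]$, \[\ell(t,a)=\begin{cases}2(1-a)t,& a\ge\frac12,\\ \frac{t}{2a},& a\ge t\text{ and }0<a<\frac12,\\ 1-\frac{a}{2t},& a<t,\\ 0,& a=t=0,\end{cases}\] and $\ell(t,a)=\ell(1-t,a)$ for $t\in(\frac12,1]$. For a distribution $Q$ on $[0,1]$, \[L_\alpha(Q)=\inf\{\mathbb{E}_{T\sim Q}[\ell(T,a(T))]: a:[0,1]\to[0,1]\text{ measurable},\ \mathbb{E}_{T\sim Q}[a(T)]\le\alpha\}.\] Partition notation: the $\mathcal{X}_m$ are disjoint measurable sets; $m(x)$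 is the index with $x\in\mathcal{X}_{m(x)}$; $p_{P,m}=\mathbb{P}_{P_X}\{X\in\mathcal{X}_m\}$; $\pi_{P,m}=\mathbb{E}_{P_X}[\pi_P(X)\mid X\in\mathcal{X}_m]$. The blur of the partition is $\Delta_P(\mathcal{X}_{1:M})=\mathbb{E}_{P_X}[|\pi_P(X)-\pi_{P,m(X)}|]$. Functions $f_{t,a}:[0,1]\to[0,1]$: for $t\in[0,\frac12]$, \[f_{t,a}(s)=\begin{cases}(1-a)\cdot\mathbf{1}\{s=0\},& t=0,\\ 1-a,& t=\frac12,\\ 2(1-a)\max\{1-\frac{s}{2t},0\},& 0<t<\frac12,\ a\ge\frac12,\\ \max\{1-\frac{as}{t},0\},& 0<t<\frac12,\ a<\frac12,\end{cases}\] and $f_{t,a}(s)=f_{1-t,a}(1-s)$ for $t\in(\frac12,1]$. For $\mathbf t=(t_1,\dots,t_M),\mathbf a=(a_1,\dots,a_M)\in[0,1]^M$ and $x\in\mathbb{R}^d$, draw $U\sim\mathrm{Unif}[0,1]$ independently of everything else and set \[C_{\mathbf t,\mathbf a}(x)=\{s\in[0,1]: f_{t_{m(x)},a_{m(x)}}(s)\ge U\}.\] Construction of $\widehat{C}_n$: let $\widehat p_m=\frac1n\sum_{i=1}^n\mathbf 1\{X_i\in\mathcal{X}_m\}$ and $\widehat\pi_m=\frac{\sum_{i=1}^n\mathbf 1\{X_i\in\mathcal{X}_m,Y_i=1\}}{n\widehat p_m}$, with $\widehat\pi_m=\frac12$ if $\widehat p_m=0$. Let \[\tilde p_m=\widehat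 p_m+\sqrt{\widehat p_m\cdot\tfrac{3\log(4Mn/\alpha)}{n}}+\tfrac{3\log(4Mn/\alpha)}{n},\] \[\tilde\pi_m=\begin{cases}\min\Big\{\frac12,\ \widehat\pi_m+\sqrt{\widehat\pi_m\cdot\frac{2\log(4Mn/\alpha)}{n\widehat p_m}}+\frac{2\log(4Mn/\alpha)}{n\widehat p_m}\Big\},&\widehat\pi_m\le\frac12,\\[4pt] \max\Big\{\frac12,\ \widehat\pi_m-\sqrt{(1-\widehat\pi_m)\cdot\frac{2\log(4Mn/\alpha)}{n\widehat p_m}}-\frac{2\log(4Mn/\alpha)}{n\widehat p_m}\Big\},&\widehat\pi_m>\frac12\end{cases}\] (so $\tilde\pi_m=\frac12$ when $\widehat p_m=0$). Let $\tilde{\boldsymbol\pi}=(\tilde\pi_1,\dots,\tilde\pi_M)$ and let $\tilde{\mathbf a}=(\tilde a_1,\dots,\tilde a_M)$ be a minimizer \[\tilde{\mathbf a}\in\operatorname*{argmin}_{a_1,\dots,a_M\in[0,1]}\Big\{\sum_{m=1}^M\tilde p_m\,\ell(\tilde\pi_m,a_m)\ :\ \sum_{m=1}^M\tilde p_m a_m\le\alpha\Big\}.\] Then $\widehat{C}_n(x)=C_{\tilde{\boldsymbol\pi},\tilde{\mathbf a}}(x)$, with $U$ independent of the data. *)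

(* Defs.v *)
From HB Require Import structures.
From mathcomp Require Import all_boot all_order all_algebra.
From mathcomp Require Import all_classical all_reals all_analysis.
Set Implicit Arguments.
Unset Strict Implicit.
Unset Printing Implicit Defensive.
Import Order.TTheory GRing.Theory Num.Theory.
Import numFieldNormedType.Exports.
Local Open Scope classical_set_scope.
Local Open Scope ring_scope.

Definition unif01 (R : realType) : probability (measurableTypeR R) R :=
  uniform_prob (@ltr01 R).

(* R^d, with its Borel sigma-algebra given as the product sigma-algebra. *)
Notation Rvec R d := (d.-tuple R) (only parsing).

(* A data point (x, y); the label y = 1 is encoded as [true]. *)
Notation datapt R d := (d.-tuple R * bool)%type.

HB.instance Definition _ d1 d2 (T1 : measurableType d1) (T2 : measurableType d2) :=
  isMeasurableFun.Build _ _ _ _ (@fst T1 T2) measurable_fst.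

Section model.
Context {R : realType} {d : nat}.

Definition marginalX (P : probability (datapt R d) R) : probability (Rvec R d) R :=
  distribution P (@fst (Rvec R d) bool).

(* [piP] is a version of x |-> P(Y = 1 | X = x).  Such versions agree only
   P_X-almost everywhere, so results are stated for every one of them. *)
Definition is_regression (P : probability (datapt R d) R)
    (piP : {mfun Rvec R d >-> R}) : Prop :=
  (forall x, 0 <= piP x <= 1) /\
  forall A : set (Rvec R d), measurable A ->
    P (A `*` [set true]) = (\int[marginalX P]_(x in A) (piP x)%:E)%E.

(* The data points Z_0, ..., Z_n are i.i.d. from P, and W is drawn from nu
   independently of them.  Taking some of the events below to be the full
   space yields the product rule for every subfamily. *)
Definition iid_sample (n : nat) dV (V : measurableType dV) (nu : probability V R)
    (P : probability (datapt R d) R)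
    dO (O : measurableType dO) (Pr : probability O R)
    (Z : 'I_n.+1 -> {RV Pr >-> datapt R d}) (W : {RV Pr >-> V}) : Prop :=
  [/\ forall i (A : set (datapt R d)), measurable A ->
        distribution Pr (Z i) A = P A,
      forall B : set V, measurable B -> distribution Pr W B = nu B &
      forall (A : 'I_n.+1 -> set (datapt R d)) (B : set V),
        (forall i, measurable (A i)) -> measurable B ->
        Pr ((\bigcap_i (Z i @^-1` A i)) `&` W @^-1` B) =
        ((\prod_(i < n.+1) Pr (Z i @^-1` A i)) * Pr (W @^-1` B))%E].

Definition training (n : nat) (T : Type) (Z : 'I_n.+1 -> T -> datapt R d) (w : T) :
    n.-tuple (datapt R d) :=
  [tuple Z (widen_ord (leqnSn n) i) w | i < n].

Definition testX (n : nat) (T : Type) (Z : 'I_n.+1 -> T -> datapt R d) (w : T) :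
    Rvec R d :=
  (Z ord_max w).1.

(* [C z v x] is the set output on the training data z, the realization v (of
   law nu) of the additional randomness, and the point x.  As a measure is
   meaningful only on measurable sets, the coverage event is also required to
   be measurable. *)
Definition distribution_free_ci (n : nat) dV (V : measurableType dV)
    (nu : probability V R)
    (C : n.-tuple (datapt R d) -> V -> Rvec R d -> set R) (alpha : R) : Prop :=
  forall (P : probability (datapt R d) R) (piP : {mfun Rvec R d >-> R}),
    is_regression P piP ->
  forall dO (O : measurableType dO) (Pr : probability O R)
      (Z : 'I_n.+1 -> {RV Pr >-> datapt R d}) (W : {RV Pr >-> V}),
    iid_sample nu P Z W ->
  let E := [set w | piP (testX Z w) \in C (training Z w) (W w) (testX Z w)] in
  measurable E /\ ((1 - alpha)%:E <= Pr E)%E.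

End model.

Section lengths.
Context {R : realType}.
Implicit Types (t a s : R).

Definition ell_half t a : R :=
  if 1 / 2 <= a then 2 * (1 - a) * t
  else if a < t then 1 - a / (2 * t)
  else if 0 < a then t / (2 * a)
  else 0.

Definition ell t a : R := if t <= 1 / 2 then ell_half t a else ell_half (1 - t) a.

Definition optimal_length (alpha : R) (Q : probability R R) : \bar R :=
  let I : set R := `[0%R, 1%R]%classic in
  ereal_inf [set (\int[Q]_(t in I) (ell t (a t))%:E)%E | a in
    [set a : R -> R | [/\ measurable_fun I a,
                         forall t, 0 <= t <= 1 -> 0 <= a t <= 1 &
                         (\int[Q]_(t in I) (a t)%:E <= alpha%:E)%E]]].

Definition f_half t a s : R :=
  if t == 0 then (1 - a) * (s == 0)%:R
  else if t == 1 / 2 then 1 - a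
  else if 1 / 2 <= a then 2 * (1 - a) * Num.max (1 - s / (2 * t)) 0
  else Num.max (1 - a * s / t) 0.

Definition f_ta t a s : R :=
  if t <= 1 / 2 then f_half t a s else f_half (1 - t) a (1 - s).

End lengths.

Section partitions.
Context {R : realType} {d M : nat}.

Record mpartition := MPartition {
  cell : 'I_M -> set (Rvec R d);
  cell_measurable : forall m, measurable (cell m);
  cell_disjoint : trivIset [set: 'I_M] cell;
  cell_cover : \bigcup_m cell m = [set: Rvec R d] }.

Lemma cell_ex (X : mpartition) (x : Rvec R d) : exists m, cell X m x.
Proof.
have : [set: Rvec R d] x by [].
by rewrite -(cell_cover X) => -[m _ xm]; exists m.
Qed.

Definition cell_index (X : mpartition) (x : Rvec R d) : 'I_M :=
  projT1 (cid (cell_ex X x)).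

Lemma cell_indexP (X : mpartition) x : cell X (cell_index X x) x.
Proof. exact: projT2 (cid (cell_ex X x)). Qed.

Variables (X : mpartition) (P : probability (datapt R d) R)
  (piP : {mfun Rvec R d >-> R}).

Definition cell_prob (m : 'I_M) : R := fine (marginalX P (cell X m)).

(* Takes the junk value 0 on cells of probability 0. *)
Definition cell_mean (m : 'I_M) : R :=
  (\int[marginalX P]_(x in cell X m) piP x) / cell_prob m.

Definition blur : R :=
  \int[marginalX P]_x `|piP x - cell_mean (cell_index X x)|.

End partitions.
Arguments mpartition : clear implicits.

Section construction.
Context {R : realType} {d M n : nat}.
Variables (X : mpartition R d M) (alpha : R).
Implicit Types (z : n.-tuple (datapt R d)) (t a : 'I_M -> R) (m : 'I_M).

(* The set C_{t,a}(x), for the realization u of the uniform variable. *)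
Definition C_ta t a (u : R) (x : Rvec R d) : set R :=
  [set s | 0 <= s <= 1 /\ u <= f_ta (t (cell_index X x)) (a (cell_index X x)) s].

Definition phat z m : R := (\sum_(i < n) \1_(cell X m) (tnth z i).1) / n%:R.

Definition pihat z m : R :=
  if phat z m == 0 then 1 / 2
  else (\sum_(i < n) \1_(cell X m `*` [set true]) (tnth z i)) / (n%:R * phat z m).

Definition lg : R := ln ((4 * M * n)%:R / alpha).

Definition ptilde z m : R :=
  phat z m + Num.sqrt (phat z m * (3 * lg / n%:R)) + 3 * lg / n%:R.

(* When [phat z m = 0], division by 0 returns 0, so this is 1/2 as it should. *)
Definition pitilde z m : R :=
  let r := 2 * lg / (n%:R * phat z m) in
  if pihat z m <= 1 / 2
  then Num.min (1 / 2) (pihat z m + Num.sqrt (pihat z m * r) + r)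
  else Num.max (1 / 2) (pihat z m - Num.sqrt ((1 - pihat z m) * r) - r).

Definition feasible z a : Prop :=
  (forall m, 0 <= a m <= 1) /\ \sum_(m < M) ptilde z m * a m <= alpha.

Definition objective z a : R := \sum_(m < M) ptilde z m * ell (pitilde z m) (a m).

Definition is_argmin z a : Prop :=
  feasible z a /\ forall b, feasible z b -> objective z a <= objective z b.

(* A rule choosing, for each training set, one of the possibly many minimizers.
   It is taken measurable so that the resulting interval is a random set; this
   holds for any rule that depends on the data only through the finitely many
   values of the vectors [phat] and [pihat]. *)
Definition argmin_rule (atilde : n.-tuple (datapt R d) -> 'I_M -> R) : Prop :=
  (forall z, is_argmin z (atilde z)) /\
  (forall m, measurable_fun [set: n.-tuple (datapt R d)] (atilde ^~ m)).

Definition Chat (atilde : n.-tuple (datapt R d) -> 'I_M -> R) z (u : R)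
    (x : Rvec R d) : set R :=
  C_ta (pitilde z) (atilde z) u x.

End construction.

(* Main.v *)
Require Import Defs.
From HB Require Import structures.
From mathcomp Require Import all_boot all_order all_algebra.
From mathcomp Require Import all_classical all_reals all_analysis.
From mathcomp Require Import measurable_realfun.
From mathcomp Require Import ring lra.

(** Given the training data and the test point, the randomization replaces the
    reported set by a random level set of the convex function [f_ta t a], where
    [t] and [a] are the estimated mean and the budget of the cell of the test
    point. The coverage probability at a point of regression value [s] is then
    [f_ta t a s] ([coverage_prob]), and the expected length is the area below
    [f_ta t a], which is [ell t a] ([integral_f_ta], [expected_length]). What
    remains concerns only the masses and means of finitely many cells and their
    empirical counterparts.

    Coverage. The function [f_ta t a] lies above an affine function with value
    [1 - a] at [t] that does not decrease in the direction from 1/2 through [t]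
    ([f_ta_minorant]). Averaging over a cell, the coverage is at least [1 - a]
    once [t] lies between the cell mean and 1/2, which is what the displacement
    of [pitilde] towards 1/2 ensures ([pitilde_side]). The failures of this, and
    of the inequality between the mass of a cell and [ptilde], have probability
    at most [3 * alpha / (4 * n)]. As the guarantee is exactly [1 - alpha], they
    must be paid for: [ptilde] exceeds the mass by a further [L / n], with [L]
    the logarithmic factor, so that at most [alpha * n / (n + L)] of the budget
    is spent ([good_coverage]).

    Length. The function [ell t] is convex in [a], and the minimum over [a] of
    [ell t a + l * a] is
    [pen_length l t = min (1, l, sqrt (2 * l * end_dist t))]. A Lagrange
    multiplier [l] for the estimated problem bounds its optimal value by the sum
    of [ptilde * pen_length l pitilde] over the cells, minus [l * alpha]
    ([lagrange_multiplier]); weak duality with the same [l] bounds the ideal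
    length from below by the expectation of [pen_length l (piP x)] minus
    [l * alpha] ([optimal_length_dual]). It remains to compare [pen_length l] at
    [pitilde], at the cell mean and at [piP x]. A multiplier above [1 / alpha]
    gives a trivial bound; otherwise [pen_length l] is Lipschitz, with constant
    [sqrt (2 / alpha)], in the square root of [end_dist]. On that scale
    Bernstein-type deviations of the frequencies are homogeneous, which yields
    the error of estimation ([sum_pen_length_error]), while the Hoelder bound
    and Jensen's inequality for the square root yield the blur term
    ([expectation_pen_length_cells]).

    Concentration. Given the number of points in a cell, the number of positive
    labels among them is binomial. [chernoff_mgf] expresses this without
    conditioning, by summing over the patterns of membership in the cell and
    choosing the exponent as a function of the pattern. *)

Set Implicit Arguments.
Unset Strict Implicit.
Unset Printing Implicit Defensive.
Import Order.TTheory GRing.Theory Num.Theory.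
Import numFieldNormedType.Exports.
Local Open Scope classical_set_scope.
Local Open Scope ring_scope.

(** * Duality for the length function *)

Section duality.
Context {R : realType}.
Implicit Types t a b l s x y : R.

Definition end_dist t : R := Num.min t (1 - t).

(** The minimum over [a] of [ell t a + l * a], in closed form: the three entries
    are the values at [a = 0], at [a = 1], and at the stationary point
    [a = sqrt (end_dist t / (2 * l))]. *)
Definition pen_length l t : R := Num.min (Num.min 1 l) (Num.sqrt (2 * l * end_dist t)).

Lemma ell_end_dist t a : ell t a = ell_half (end_dist t) a.
Proof.
rewrite /ell /end_dist /Num.min; case: ifPn; case: ifPn => //.
- by move=> h1 h2; congr ell_half; lra.
- by move=> h1 h2; lra.
Qed.

Lemma end_dist_bounds t : 0 <= t <= 1 -> 0 <= end_dist t <= 1 / 2.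
Proof. by rewrite /end_dist /Num.min; case: ifPn => h1 h2; lra. Qed.

Lemma sqr_le_sqrt x y : 0 <= x -> x ^+ 2 <= y -> x <= Num.sqrt y.
Proof. by move=> x0 xy; rewrite -(ger0_norm x0) -sqrtr_sqr ler_wsqrtr. Qed.

Lemma sqrt_le_sqr x y : 0 <= y -> x <= y ^+ 2 -> Num.sqrt x <= y.
Proof. by move=> y0 xy; rewrite -(ger0_norm y0) -sqrtr_sqr ler_wsqrtr. Qed.

(** Each piece of [ell] in [a] is affine, or handled by the arithmetic-geometric
    mean inequality; an affine piece lies above the smaller of its endpoint
    values. *)
Lemma pen_length_le l t a : 0 <= l -> 0 <= t <= 1 -> 0 <= a <= 1 ->
  pen_length l t <= ell t a + l * a.
Proof.
move=> l0 /end_dist_bounds; rewrite ell_end_dist /pen_length.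
move: (end_dist t) => {}t t01 a01; rewrite /ell_half.
have amgm x : 0 <= x -> 2 * l * t <= x ^+ 2 -> Num.sqrt (2 * l * t) <= x.
  by move=> *; exact: sqrt_le_sqr.
case: ifPn => [ha|/negP ha].
  have h1 : Num.sqrt (2 * l * t) <= t + l / 2.
    by apply: amgm; [lra|have := sqr_ge0 (t - l / 2); lra].
  rewrite 2!ge_min orbC.
  have [lx|lx] := leP (Num.sqrt (2 * l * t)) l.
    by apply/orP; left; nra.
  apply/orP; right; apply/orP; right; nra.
case: ifPn => [hat|/negP hat].
  have t0 : 0 < t by lra.
  have h1 : Num.sqrt (2 * l * t) <= 1 / 2 + l * t.
    apply: amgm; first by nra.
    by have := sqr_ge0 (1 / 2 - l * t); lra.
  have -> : 1 - a / (2 * t) + l * a = 1 - a / t + (a / t) * (1 / 2 + l * t).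
    by field; lra.
  have a0 : 0 <= a / t by rewrite divr_ge0//; lra.
  have a1 : a / t <= 1 by rewrite ler_pdivrMr//; lra.
  rewrite 2!ge_min orbC.
  have [lx|lx] := leP (Num.sqrt (2 * l * t)) 1.
    by apply/orP; left; nra.
  by apply/orP; right; apply/orP; left; nra.
case: ifPn => [a0|/negP a0].
  rewrite 2!ge_min; apply/orP; right; apply: amgm.
    by rewrite addr_ge0// ?divr_ge0//; nra.
  have -> : t = a * 2 * (t / (2 * a)) by field; lra.
  set u := t / (2 * a); have u0 : 0 <= u by rewrite divr_ge0//; nra.
  have := sqr_ge0 (u - l * a).
  have -> : a * 2 * u / (2 * a) = u by field; lra.
  rewrite !expr2; nra.
have -> : t = 0 by lra.
rewrite mulr0 sqrtr0 ge_min; apply/orP; right; nra.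
Qed.

Lemma pen_length_attained l t : 0 <= l -> 0 <= t <= 1 ->
  exists2 a, 0 <= a <= 1 & ell t a + l * a <= pen_length l t.
Proof.
move=> l0 /end_dist_bounds; rewrite /pen_length.
have [h|h] := leP (Num.min 1 l) (Num.sqrt (2 * l * end_dist t)).
  move=> t01; rewrite minElt; case: ifPn => h1.
    exists 0; first by rewrite lexx ler01.
    rewrite ell_end_dist /ell_half (mulr0 l) addr0 ltxx.
    case: ifPn => [|_]; first by lra.
    case: ifPn => [|_]; first by rewrite mul0r subr0.
    exact: ler01.
  exists 1; first by rewrite lexx ler01.
  rewrite ell_end_dist /ell_half mulr1.
  case: ifPn => [_|]; last by lra.
  by lra.
move: h; rewrite lt_min => /andP[h1 h2] t01.
suff [a a01 ea] : exists2 a, 0 <= a <= 1 &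
    ell_half (end_dist t) a + l * a <= Num.sqrt (2 * l * end_dist t).
  by exists a; rewrite // ell_end_dist.
move: (end_dist t) h1 h2 t01 => {}t h1 h2 t01.
have l1 : 0 < l by exact: le_lt_trans h2.
have h : 0 <= 2 * l * t by nra.
have h3 : 2 * l * t < 1.
  by rewrite -(sqr_sqrtr h) expr_lt1// sqrtr_ge0.
have h4 : 2 * l * t < l ^+ 2.
  by rewrite -(sqr_sqrtr h) ltr_pXn2r// ?nnegrE ?sqrtr_ge0// ltW.
set w := Num.sqrt (2 * l * t) in h1 h2 *.
have w2 : w ^+ 2 = 2 * l * t by rewrite sqr_sqrtr.
have w0 : 0 <= w by exact: sqrtr_ge0.
exists (w / (2 * l)).
  rewrite divr_ge0 ?ler_pdivrMr; lra.
have t2 : t = w ^+ 2 / (2 * l) by rewrite w2; field; lra.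
rewrite /ell_half; case: ifPn => [|/negP ha].
  by rewrite ler_pdivlMr; lra.
case: ifPn => [|/negP hat].
  rewrite t2 ltr_pM2r; last by rewrite invr_gt0; lra.
  by rewrite expr2; nra.
case: ifPn => [a0|/negP a0].
  have wp : 0 < w.
    by move: a0; rewrite pmulr_lgt0// invr_gt0; lra.
  by rewrite {1}t2 le_eqVlt; apply/orP; left; apply/eqP; field; lra.
have -> : w = 0.
  have : ~ 0 < w by move=> wp; apply: a0; rewrite divr_gt0; lra.
  lra.
by rewrite mul0r mulr0 addr0.
Qed.

(** The multiplier is minus the slope of [ell t] at [a]. With [pen_length_le], this
    exhibits [ell t] as a supremum of affine functions of [a]. *)
Lemma ell_tight t a : 0 <= t <= 1 -> 0 <= a <= 1 ->
  exists2 l, 0 <= l & ell t a + l * a <= pen_length l t.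
Proof.
move=> /end_dist_bounds; rewrite ell_end_dist /pen_length.
move: (end_dist t) => {}t t01 a01; rewrite /ell_half.
have key x w : 0 <= x -> x ^+ 2 <= w -> x <= Num.sqrt w := @sqr_le_sqrt x w.
case: ifPn => [ha|/negP ha].
  exists (2 * t); first by lra.
  rewrite !le_min; apply/andP; split; first by apply/andP; split; lra.
  apply: key; first nra.
  by rewrite expr2; nra.
case: ifPn => [hat|/negP hat].
  have t0 : 0 < t by lra.
  exists (2 * t)^-1; first by rewrite invr_ge0; lra.
  have -> : 1 - a / (2 * t) + (2 * t)^-1 * a = 1 by field; lra.
  rewrite !le_min lexx /=; apply/andP; split.
    by rewrite invf_ge1; lra.
  apply: key; first exact: ler01.
  by have -> : 2 * (2 * t)^-1 * t = 1 by field; lra.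
case: ifPn => [a0|/negP a0].
  exists (t / (2 * a ^+ 2)); first by rewrite divr_ge0; nra.
  have -> : t / (2 * a) + t / (2 * a ^+ 2) * a = t / a by field; lra.
  rewrite !le_min; apply/andP; split; first apply/andP; first split.
  - by rewrite ler_pdivrMr; lra.
  - have -> : t / (2 * a ^+ 2) = t / a * (2 * a)^-1 by field; lra.
    by rewrite ler_peMr ?divr_ge0// ?invf_ge1; lra.
  - apply: key; first by rewrite divr_ge0; lra.
    rewrite le_eqVlt; apply/orP; left; apply/eqP; field; lra.
by exists 0; rewrite ?mul0r ?mulr0 ?mul0r ?addr0 ?sqrtr0 ?le_min ?lexx ?ler01.
Qed.

Lemma ell_convex t a b s : 0 <= t <= 1 -> 0 <= a <= 1 -> 0 <= b <= 1 ->
  0 <= s <= 1 ->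
  ell t (s * a + (1 - s) * b) <= s * ell t a + (1 - s) * ell t b.
Proof.
move=> t01 a01 b01 s01.
have ab01 : 0 <= s * a + (1 - s) * b <= 1 by nra.
have [l l0] := ell_tight t01 ab01.
have := pen_length_le l0 t01 a01; have := pen_length_le l0 t01 b01; nra.
Qed.

Lemma ell_bounds t a : 0 <= t <= 1 -> 0 <= a <= 1 -> 0 <= ell t a <= 1.
Proof.
move=> /end_dist_bounds; rewrite ell_end_dist.
move: (end_dist t) => {}t t01 a01; rewrite /ell_half.
case: ifPn => [ha|/negP ha]; first by nra.
case: ifPn => [hat|/negP hat].
  have h : 0 <= a / (2 * t) by rewrite divr_ge0; lra.
  have : a / (2 * t) <= 1 by rewrite ler_pdivrMr; lra.
  lra.
case: ifPn => [a0|/negP a0]; last by rewrite lexx ler01.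
by rewrite divr_ge0 ?ler_pdivrMr; lra.
Qed.

Lemma pen_length_bounds l t : 0 <= l -> 0 <= pen_length l t <= 1.
Proof.
move=> l0; rewrite /pen_length !le_min sqrtr_ge0 l0 ler01 /=.
by rewrite ge_min ge_min lexx.
Qed.

Lemma pen_length_diff_le l t s : 0 <= l -> 0 <= t <= 1 -> 0 <= s <= 1 ->
  pen_length l t - pen_length l s <=
  Num.max 0 (Num.sqrt (2 * l * end_dist t) - Num.sqrt (2 * l * end_dist s)).
Proof.
move=> l0 t01 s01; rewrite /pen_length /Num.max /Num.min.
repeat case: ifPn => //; lra.
Qed.

Lemma end_dist_lip t s : end_dist t <= end_dist s + `|t - s|.
Proof.
rewrite /end_dist /Num.min; have := ler_norm (t - s); have := ler_norm (s - t).
by rewrite distrC; repeat case: ifPn => //; lra.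
Qed.

Lemma sqrtD_le x y : 0 <= x -> 0 <= y -> Num.sqrt (x + y) <= Num.sqrt x + Num.sqrt y.
Proof.
move=> x0 y0; apply: sqrt_le_sqr; first by rewrite addr_ge0 ?sqrtr_ge0.
have := sqr_sqrtr x0; have := sqr_sqrtr y0.
by have := sqrtr_ge0 x; have := sqrtr_ge0 y; nra.
Qed.

(** Since [pen_length] depends on [t] only through the square root of [end_dist t],
    it is Hoelder of order 1/2, whereas the Lipschitz constant of [ell t a] in
    [t] blows up as [a] tends to 0. *)
Lemma pen_length_holder l t s : 0 <= l -> 0 <= t <= 1 -> 0 <= s <= 1 ->
  pen_length l t <= pen_length l s + Num.sqrt (2 * l * `|t - s|).
Proof.
move=> l0 t01 s01; have := pen_length_diff_le l0 t01 s01.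
have : Num.sqrt (2 * l * end_dist t) <=
       Num.sqrt (2 * l * end_dist s) + Num.sqrt (2 * l * `|t - s|).
  have /andP[ts _] := end_dist_bounds s01.
  have h : 0 <= 2 * l * end_dist s by rewrite !mulr_ge0.
  have h' : 0 <= 2 * l * `|t - s| by rewrite !mulr_ge0.
  apply: le_trans (sqrtD_le h h').
  apply: ler_wsqrtr.
  rewrite -mulrDr; apply: ler_wpM2l; last exact: end_dist_lip.
  by rewrite mulr_ge0.
have := sqrtr_ge0 (2 * l * `|t - s|).
by rewrite /Num.max; case: ifPn; lra.
Qed.

End duality.

(** * A Lagrange multiplier for the budget constraint *)

Section lagrange.
Context {R : realType} {M : nat}.
Implicit Types (p t a b : 'I_M -> R) (alpha l : R).

(** The multiplier is the supremum of the decrease in objective per unit of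
    overspending. It is finite because, by convexity, mixing an overspending
    [b] with an underspending [b'] gives a feasible point, so that no
    overspending rate exceeds an underspending rate. *)
Lemma lagrange_multiplier p t a alpha :
  0 < alpha -> (forall m, 0 <= p m) -> (forall m, 0 <= t m <= 1) ->
  (forall m, 0 <= a m <= 1) ->
  (forall b, (forall m, 0 <= b m <= 1) -> \sum_m p m * b m <= alpha ->
     \sum_m p m * ell (t m) (a m) <= \sum_m p m * ell (t m) (b m)) ->
  exists2 l, 0 <= l &
    \sum_m p m * ell (t m) (a m) <= \sum_m p m * pen_length l (t m) - l * alpha.
Proof.
move=> alpha0 p0 t01 a01 amin.
pose F b := \sum_m p m * ell (t m) (b m).
pose g b := \sum_m p m * b m.
pose K b := forall m, 0 <= b m <= 1.
pose slopes := [set s | s = 0 \/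
  exists b, [/\ K b, alpha < g b & s = (F a - F b) / (g b - alpha)]].
have slope_le b' : K b' -> g b' < alpha ->
    ubound slopes ((F b' - F a) / (alpha - g b')).
  move=> Kb' gb' _ [->|[b [Kb gb ->]]].
    by rewrite divr_ge0 ?subr_ge0// ?amin// ltW.
  have d1 : 0 < g b - alpha by rewrite subr_gt0.
  have d2 : 0 < alpha - g b' by rewrite subr_gt0.
  (* the convex combination of b and b' that spends exactly alpha *)
  pose s := (alpha - g b') / (g b - g b').
  have s01 : 0 <= s <= 1.
    by rewrite /s divr_ge0 ?ler_pdivrMr; lra.
  pose c m := s * b m + (1 - s) * b' m.
  have Kc : K c by move=> m; have := Kb m; have := Kb' m; rewrite /c; nra.
  have gc : g c = alpha.
    have -> : g c = s * g b + (1 - s) * g b'.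
      by rewrite /g !mulr_sumr -big_split; apply: eq_bigr => m _;
        rewrite /c /=; ring.
    by rewrite /s; field; lra.
  have Fc : F c <= s * F b + (1 - s) * F b'.
    rewrite /F !mulr_sumr -big_split; apply: ler_sum => m _.
    have := ell_convex (t01 m) (Kb m) (Kb' m) s01.
    move=> /(ler_wpM2l (p0 m)) /le_trans; apply.
    by rewrite le_eqVlt; apply/orP; left; apply/eqP => /=; ring.
  have Fa : F a <= F c by apply: amin => //; rewrite -/(g c) gc.
  rewrite ler_pdivrMr// mulrAC ler_pdivlMr//.
  have sd : s * (g b - g b') = alpha - g b' by rewrite /s; field; lra.
  have e1 : 1 - s = (g b - alpha) / (g b - g b') by rewrite /s; field; lra.
  have := le_trans Fa Fc; rewrite e1 /s => h.
  have dd : 0 < g b - g b' by lra.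
  have : F a * (g b - g b') <= (alpha - g b') * F b + (g b - alpha) * F b'.
    rewrite -ler_pdivlMr//; apply: (le_trans h).
    by rewrite le_eqVlt; apply/orP; left; apply/eqP; field; lra.
  by move: (F a) (F b) (F b') (g b) (g b') => *; lra.
have slopes0 : slopes 0 by left.
have K0 : K (fun=> 0) by move=> m; rewrite lexx ler01.
have g0 : g (fun=> 0) = 0 by rewrite /g big1// => m _; rewrite mulr0.
have slopes_bnd : has_ubound slopes.
  by eexists; apply: (slope_le (fun=> 0)); rewrite ?g0.
pose l := sup slopes.
have l0 : 0 <= l by exact: ub_le_sup.
have lag b : K b -> F a <= F b + l * (g b - alpha).
  move=> Kb; have [gb|gb|gb] := ltgtP (g b) alpha.
  - have : l <= (F b - F a) / (alpha - g b).
      by apply: ge_sup; [exists 0|exact: slope_le].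
    by rewrite ler_pdivlMr; lra.
  - have : (F a - F b) / (g b - alpha) <= l.
      by apply: ub_le_sup => //; right; exists b.
    by rewrite ler_pdivrMr; lra.
  - by rewrite gb subrr mulr0 addr0 amin// -/(g b) gb.
exists l => //.
have /choice[b bP] : forall m, exists x : R,
    0 <= x <= 1 /\ ell (t m) x + l * x <= pen_length l (t m).
  by move=> m; have [x] := pen_length_attained l0 (t01 m); exists x.
have Kb : K b by move=> m; have [] := bP m.
apply: (le_trans (lag _ Kb)).
rewrite mulrBr addrA lerD2r /F /g mulr_sumr -big_split /=.
apply: ler_sum => m _; have [_] := bP m.
by move=> /(ler_wpM2l (p0 m)); lra.
Qed.

End lagrange.

(** * The level functions and their areas *)

Section level_function.
Context {R : realType}.
Implicit Types t a s c e : R.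

(** On this range [f_half t a] is an affine function truncated at its zero [x]
    (or at 1); the affine function equals [1 - a] at [t]. The coverage and the
    area of the level function are both read off from it. *)
Lemma f_half_shape t a : 0 < t <= 1 / 2 -> 0 <= a <= 1 ->
  exists c e x, [/\ 0 <= x <= 1,
    forall s, 0 <= s <= x -> f_half t a s = c + e * s,
    forall s, x < s <= 1 -> f_half t a s = 0,
    c * x + e * x ^+ 2 / 2 = ell_half t a &
    [/\ forall s, 0 <= s <= 1 -> 0 <= f_half t a s <= 1,
     forall s, c + e * s <= f_half t a s,
     c + e * t = 1 - a, e <= 0 & (t = 1 / 2 -> e = 0) ] ].
Proof.
move=> /andP[t0 th] a01; rewrite /f_half /ell_half gt_eqF//.
have tn0 : t != 0 by rewrite gt_eqF.
have [t2|t2] := eqVneq t (1 / 2).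
  exists (1 - a), 0, 1; split=> [|s _|s s1||].
  - by rewrite ler01 lexx.
  - by rewrite mul0r addr0.
  - lra.
  - case: ifPn => [|ha]; first by rewrite t2; lra.
    case: ifPn; last by lra.
    by rewrite t2 => _; field.
  - by split=> // [s s01|s|]; lra.
have {t2}th : t < 1 / 2 by rewrite lt_neqAle t2.
case: ifPn => [ha|/negP ha].
  exists (2 * (1 - a)), (- ((1 - a) / t)), (2 * t).
  have e0 : 0 <= (1 - a) / t by rewrite divr_ge0; lra.
  have fE s : 2 * (1 - a) + - ((1 - a) / t) * s = 2 * (1 - a) * (1 - s / (2 * t)).
    by field.
  split=> [|s s01|s s1||]; first lra.
  - rewrite fE max_l// subr_ge0 ler_pdivrMr; lra.
  - rewrite max_r ?mulr0// subr_le0 ler_pdivlMr; lra.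
  - by field.
  - split => [s s01|s|||]; last by lra.
    + have [h|h] := leP (1 - s / (2 * t)) 0; first by rewrite mulr0 lexx ler01.
      have : 0 <= s / (2 * t) by rewrite divr_ge0; lra.
      by move: h; set u := s / (2 * t) => *; nra.
    + rewrite fE; apply: ler_wpM2l; first lra.
      by rewrite le_max lexx.
    + by field.
    + by rewrite oppr_le0.
have fE s : 1 + - (a / t) * s = 1 - a * s / t by field.
have e0 : 0 <= a / t by rewrite divr_ge0; lra.
have common : [/\ forall s, 0 <= s <= 1 -> 0 <= Num.max (1 - a * s / t) 0 <= 1,
     forall s, 1 + - (a / t) * s <= Num.max (1 - a * s / t) 0,
     1 + - (a / t) * t = 1 - a, - (a / t) <= 0 & (t = 1 / 2 -> - (a / t) = 0) ].
  split => [s s01|s|||]; last by lra.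
  - rewrite le_max lexx orbT /= ge_max ler01 andbT.
    by rewrite lerBlDr lerDl divr_ge0 ?mulr_ge0; lra.
  - by rewrite fE le_max lexx.
  - by field.
  - by rewrite oppr_le0.
case: ifPn => [hat|/negP hat].
  exists 1, (- (a / t)), 1; split=> // [|s s01|s|].
  - by rewrite lexx ler01.
  - by rewrite fE max_l// subr_ge0 ler_pdivrMr; nra.
  - lra.
  - by field.
have a0 : 0 < a by lra.
rewrite a0; exists 1, (- (a / t)), (t / a); split=> // [|s s01|s s01|].
- by rewrite divr_ge0 ?ler_pdivrMr; lra.
- rewrite fE max_l// subr_ge0 ler_pdivrMr// mul1r mulrC -ler_pdivlMr//; lra.
- rewrite max_r// subr_le0 ler_pdivlMr// mul1r mulrC -ler_pdivrMr//; lra.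
- by field; lra.
Qed.

Lemma f_ta_ge0_le1 t a s : 0 < t < 1 -> 0 <= a <= 1 -> 0 <= s <= 1 ->
  0 <= f_ta t a s <= 1.
Proof.
move=> t01 a01 s01; rewrite /f_ta; case: ifPn => th.
  have [|c [e [x [_ _ _ _ [h _ _ _ _]]]]] := @f_half_shape t a _ a01; first lra.
  exact: h.
have [|c [e [x [_ _ _ _ [h _ _ _ _]]]]] := @f_half_shape (1 - t) a _ a01; first lra.
apply: h; lra.
Qed.

Lemma f_ta_minorant t a : 0 < t < 1 -> 0 <= a <= 1 ->
  exists c e, [/\ forall s, c + e * s <= f_ta t a s, c + e * t = 1 - a,
     (t <= 1 / 2 -> e <= 0) & (1 / 2 <= t -> 0 <= e)].
Proof.
move=> t01 a01; have [th|th] := leP t (1 / 2).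
  have [|c [e [x [_ _ _ _ [_ hm ct e0 t2]]]]] := @f_half_shape t a _ a01; first lra.
  exists c, e; split=> // [s|ht]; first by rewrite /f_ta th.
  by rewrite t2//; lra.
have [|c [e [x [_ _ _ _ [_ hm ct e0 t2]]]]] := @f_half_shape (1 - t) a _ a01; first lra.
exists (c + e), (- e); split=> [s|||]; [|lra..].
by rewrite /f_ta [t <= _]leNgt th /=; apply: le_trans (hm _); lra.
Qed.

Let mu := @lebesgue_measure R.

Lemma integral_affine c e (x y : R) : x <= y ->
  (\int[mu]_(s in `[x, y]) (c + e * s)%:E =
   (c * (y - x) + e * (y ^+ 2 - x ^+ 2) / 2)%:E)%E.
Proof.
rewrite le_eqVlt => /predU1P[->|xy].
  by rewrite set_itv1 integral_set1; congr EFin; ring.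
pose F s := c * s + e * s ^+ 2 / 2.
have dF s : is_derive s 1 F (c + e * s).
  rewrite /F; apply: is_derive_eq.
  by rewrite /GRing.scale /=; field.
transitivity ((F y)%:E - (F x)%:E)%E; last first.
  by rewrite -EFinB /F; congr EFin; field.
apply: (@continuous_FTC2 R (fun s => c + e * s) F) => //.
- apply: continuous_subspaceT => s.
  by apply: continuousD; [exact: cst_continuous|apply: continuousM; [exact: cst_continuous|]].
- split=> [s _||].
  + exact: (@ex_derive _ _ _ _ _ _ _ (dF s)).
  + apply: cvg_at_right_filter.
    apply: differentiable_continuous; apply/derivable1_diffP.
    exact: (@ex_derive _ _ _ _ _ _ _ (dF x)).
  + apply: cvg_at_left_filter.
    apply: differentiable_continuous; apply/derivable1_diffP.
    exact: (@ex_derive _ _ _ _ _ _ _ (dF y)).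
- by move=> s _; rewrite derive1E; exact: (@derive_val _ _ _ _ _ _ _ (dF s)).
Qed.

Lemma integral_piecewise (g : R -> R) c e (x y : R) :
  0 <= x -> x <= y -> y <= 1 ->
  (forall s, x <= s <= y -> g s = c + e * s) ->
  (forall s, 0 <= s <= 1 -> ~~ (x <= s <= y) -> g s = 0) ->
  (\int[mu]_(s in `[0%R, 1%R]) (g s)%:E =
   (c * (y - x) + e * (y ^+ 2 - x ^+ 2) / 2)%:E)%E.
Proof.
move=> x0 xy y1 gin gout; rewrite -integral_affine//.
have -> : `[x, y]%classic = `[0, 1]%classic `&` `[x, y]%classic :> set R.
  rewrite setIidr// => s /=; rewrite !in_itv/= => ?; lra.
rewrite integral_mkcondr; apply: eq_integral => s; rewrite inE /= in_itv /= => s01.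
rewrite patchE; case: ifPn; rewrite ?inE ?notin_setE /= in_itv /= => h.
  by rewrite gin.
by rewrite gout//; apply/negP.
Qed.

Lemma integral_f_ta t a : 0 < t < 1 -> 0 <= a <= 1 ->
  (\int[mu]_(s in `[0%R, 1%R]) (f_ta t a s)%:E = (ell t a)%:E)%E.
Proof.
move=> t01 a01; rewrite /f_ta /ell; case: ifPn => th.
  have [|c [e [x [x01 fin fout <- _]]]] := @f_half_shape t a _ a01; first lra.
  rewrite (@integral_piecewise _ c e 0 x) //; [|lra..|].
    by congr EFin; field.
  by move=> s s01 sx; apply: fout; lra.
have [|c [e [x [x01 fin fout <- _]]]] := @f_half_shape (1 - t) a _ a01; first lra.
rewrite (@integral_piecewise _ (c + e) (- e) (1 - x) 1) //; [|lra..| |].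
- by congr EFin; field.
- by move=> s s01; rewrite fin; [ring|lra].
- by move=> s s01 sx; apply: fout; lra.
Qed.

(** The inverse of [x] is [x] times a real power of [x ^+ 2], which also holds
    at 0, where the inverse is discontinuous. *)
Lemma measurable_inv : measurable_fun setT (fun x : R => x^-1).
Proof.
rewrite (_ : (fun x => _) = (fun x => x * (x ^+ 2) `^ (-1))); last first.
  apply/funext => x; rewrite powR_inv1 ?sqr_ge0//.
  have [->|x0] := eqVneq x 0; first by rewrite mul0r invr0.
  by field.
apply: measurable_funM => //; apply: (measurableT_comp (measurable_powR _)).
exact: measurable_funX.
Qed.

Lemma measurable_sqrt : measurable_fun setT (fun x : R => Num.sqrt x).
Proof. by apply: continuous_measurable_fun; exact: (@sqrt_continuous R). Qed.

Lemma measurable_f_half d (T : measurableType d) (t a s : T -> R) :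
  measurable_fun setT t -> measurable_fun setT a -> measurable_fun setT s ->
  measurable_fun setT (fun w => f_half (t w) (a w) (s w)).
Proof.
move=> mt ma ms; rewrite /f_half.
have mc (k : R) : measurable_fun setT (fun _ : T => k) by exact: measurable_cst.
have mV (u : T -> R) : measurable_fun setT u -> measurable_fun setT (fun w => (u w)^-1).
  by move=> mu'; exact: (measurableT_comp measurable_inv).
apply: measurable_fun_ifT; first exact: measurable_fun_eqr.
  apply: measurable_funM; first exact: measurable_funB.
  rewrite (_ : (fun w => _) = fun w => if s w == 0 then 1 else 0 : R); last first.
    by apply/funext => w; case: ifPn.
  by apply: measurable_fun_ifT => //; exact: measurable_fun_eqr.
apply: measurable_fun_ifT; first exact: measurable_fun_eqr.
  exact: measurable_funB.
apply: measurable_fun_ifT; first exact: measurable_fun_ler.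
  apply: measurable_funM.
    by apply: measurable_funM => //; exact: measurable_funB.
  apply: measurable_maxr => //; apply: measurable_funB => //.
  by apply: measurable_funM => //; apply: mV; exact: measurable_funM.
apply: measurable_maxr => //; apply: measurable_funB => //.
by apply: measurable_funM; [exact: measurable_funM|exact: mV].
Qed.

Lemma measurable_f_ta d (T : measurableType d) (t a s : T -> R) :
  measurable_fun setT t -> measurable_fun setT a -> measurable_fun setT s ->
  measurable_fun setT (fun w => f_ta (t w) (a w) (s w)).
Proof.
move=> mt ma ms; rewrite /f_ta.
have mc (k : R) : measurable_fun setT (fun _ : T => k) by exact: measurable_cst.
apply: measurable_fun_ifT; first exact: measurable_fun_ler.
  exact: measurable_f_half.
by apply: measurable_f_half => //; exact: measurable_funB.
Qed.

Lemma measurable_level_set d (T : measurableType d) (t a u s : T -> R) :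
  measurable_fun setT t -> measurable_fun setT a ->
  measurable_fun setT u -> measurable_fun setT s ->
  measurable [set w | 0 <= s w <= 1 /\ u w <= f_ta (t w) (a w) (s w)].
Proof.
move=> mt ma mu' ms; have mf := measurable_f_ta mt ma ms.
have mc (k : R) : measurable_fun setT (fun _ : T => k) by exact: measurable_cst.
rewrite (_ : [set w | _] = (fun w => [&& 0 <= s w, s w <= 1 &
    u w <= f_ta (t w) (a w) (s w)]) @^-1` [set true]); last first.
  apply/seteqP; split=> w /=; first by move=> [/andP[-> ->] ->].
  by move=> /and3P[h1 h2 h3]; split=> //; apply/andP.
rewrite -[X in measurable X]setTI.
have := measurable_and (measurable_fun_ler (mc 0) ms)
  (measurable_and (measurable_fun_ler ms (mc 1)) (measurable_fun_ler mu' mf)).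
by move=> /(_ measurableT [set true]); apply.
Qed.

Lemma measurable_ell d (T : measurableType d) (t a : T -> R) :
  measurable_fun setT t -> measurable_fun setT a ->
  measurable_fun setT (fun w => ell (t w) (a w)).
Proof.
move=> mt ma.
rewrite (_ : (fun w => _) = fun w => ell_half (end_dist (t w)) (a w)); last first.
  by apply/funext => w; rewrite ell_end_dist.
have mc (k : R) : measurable_fun setT (fun _ : T => k) by exact: measurable_cst.
have mtt : measurable_fun setT (fun w => end_dist (t w)).
  by apply: measurable_minr => //; exact: measurable_funB.
have mV (u : T -> R) : measurable_fun setT u -> measurable_fun setT (fun w => (u w)^-1).
  by move=> mu'; exact: (measurableT_comp measurable_inv).
rewrite /ell_half.
apply: measurable_fun_ifT; first exact: measurable_fun_ler.
  by apply: measurable_funM => //; apply: measurable_funM => //; exact: measurable_funB.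
apply: measurable_fun_ifT; first exact: measurable_fun_ltr.
  apply: measurable_funB => //; apply: measurable_funM => //.
  by apply: mV; exact: measurable_funM.
apply: measurable_fun_ifT => //; first exact: measurable_fun_ltr.
by apply: measurable_funM => //; apply: mV; exact: measurable_funM.
Qed.

Lemma measurable_pen_length d (T : measurableType d) l (t : T -> R) :
  measurable_fun setT t -> measurable_fun setT (fun w => pen_length l (t w)).
Proof.
move=> mt; rewrite /pen_length.
have mc (k : R) : measurable_fun setT (fun _ : T => k) by exact: measurable_cst.
apply: measurable_minr => //.
apply: (measurableT_comp measurable_sqrt).
apply: measurable_funM => //.
by apply: measurable_minr => //; exact: measurable_funB.
Qed.

End level_function.

(** * Chernoff bounds for counts in nested sets *)

Section exponential_bounds.
Context {R : realType}.
Implicit Types u s : R.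

Lemma expR_ge_quadratic u : 0 <= u -> 1 + u + u ^+ 2 / 2 <= expR u.
Proof.
move=> u0; have nd : nondecreasing_seq (series (exp_coeff u)).
  apply: nondecreasing_series => n _ _; rewrite /exp_coeff /=.
  by rewrite divr_ge0// exprn_ge0.
have := nondecreasing_cvgn_le nd (is_cvg_series_exp_coeff u) 3.
rewrite -/(expR u) /series /= !big_nat_recr//= big_nil /exp_coeff /=.
by rewrite expr0 expr1 add0r !divr1.
Qed.

Lemma expRN_le_quadratic u : 0 <= u -> expR (- u) <= 1 - u + u ^+ 2 / 2.
Proof.
move=> u0; have h := expR_ge_quadratic u0.
rewrite expRN; set y := expR u in h *.
have q0 : 0 < 1 + u + u ^+ 2 / 2 by nra.
have : y^-1 <= (1 + u + u ^+ 2 / 2)^-1 by rewrite lef_pV2 ?posrE//; lra.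
move=> /le_trans; apply.
rewrite -div1r ler_pdivrMr//.
have -> : (1 - u + u ^+ 2 / 2) * (1 + u + u ^+ 2 / 2) = 1 + (u ^+ 2 / 2) ^+ 2.
  by field.
by rewrite lerDl sqr_ge0.
Qed.

Lemma expR_le_quadratic s : 0 <= s <= 1 / 2 -> expR s <= 1 + s + 2 * s ^+ 2.
Proof.
move=> s01; have h := expR_ge1Dx (- s).
rewrite -[s in expR s]opprK expRN; set y := expR (- s) in h *.
have : y^-1 <= (1 - s)^-1 by rewrite lef_pV2 ?posrE//; lra.
move=> /le_trans; apply.
rewrite -div1r ler_pdivrMr; last lra.
have -> : (1 + s + 2 * s ^+ 2) * (1 - s) = 1 + s ^+ 2 * (1 - 2 * s) by ring.
by rewrite lerDl mulr_ge0 ?sqr_ge0//; lra.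
Qed.

End exponential_bounds.

(** A sample of [n] points is recorded by two patterns: [b] says which points
    lie in a set [A] of probability [pA], and [c] which lie in a subset of [A]
    of conditional probability [q]. *)
Section chernoff.
Context {R : realType} {n : nat}.
Variables (pA q : R).
Hypotheses (pA01 : 0 <= pA <= 1) (q01 : 0 <= q <= 1).
Implicit Types (b c : {ffun 'I_n -> bool}) (N K : nat).

Definition pattern_weight (x y : bool) : R :=
  if x then (if y then pA * q else pA * (1 - q)) else (if y then 0 else 1 - pA).

Definition pattern_prob b c : R := \prod_i pattern_weight (b i) (c i).

Definition nb_true b : nat := (\sum_i b i)%N.

Lemma pattern_weight_ge0 x y : 0 <= pattern_weight x y.
Proof. by have := pA01; have := q01; case: x; case: y => /= *; nra. Qed.

Lemma pattern_prob_ge0 b c : 0 <= pattern_prob b c.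
Proof. by apply: prodr_ge0 => i _; exact: pattern_weight_ge0. Qed.

(** The exponent [s] may depend on the number of points in [A], because for a
    fixed pattern [b] the sum over [c] factors over the points. Each point of
    [A] contributes at most [pA], from [1 + x <= expR x]. *)
Lemma chernoff_mgf (s : nat -> R) :
  \sum_b \sum_c pattern_prob b c *
    expR (s (nb_true b) * (nb_true c)%:R
          - (nb_true b)%:R * (q * (expR (s (nb_true b)) - 1))) <= 1.
Proof.
have tot : \sum_(b : {ffun 'I_n -> bool}) \prod_(i < n) (if b i then pA else 1 - pA) = 1.
  rewrite -(bigA_distr_bigA (fun (i : 'I_n) (x : bool) => if x then pA else 1 - pA)).
  by rewrite big1// => i _; rewrite big_bool /=; ring.
rewrite -[leRHS]tot; apply: ler_sum => b _.
set s0 := s _; set th := q * (expR s0 - 1).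
pose phi (x y : bool) := pattern_weight x y * expR (s0 * y%:R - x%:R * th).
have -> : \sum_c pattern_prob b c *
    expR (s0 * (nb_true c)%:R - (nb_true b)%:R * th) =
    \sum_(c : {ffun 'I_n -> bool}) \prod_i phi (b i) (c i).
  apply: eq_bigr => c _; rewrite /phi big_split /=; congr (_ * _).
  rewrite -expR_sum; congr expR.
  by rewrite sumrB /nb_true !natr_sum mulr_sumr mulr_suml.
rewrite -(bigA_distr_bigA (fun (i : 'I_n) y => phi (b i) y)).
apply: ler_prod => i _; apply/andP; split.
  by rewrite sumr_ge0// => y _; rewrite mulr_ge0 ?expR_ge0// pattern_weight_ge0.
rewrite big_bool /phi /=; case: (b i) => /=; last first.
  by rewrite !mul0r subr0 mulr0 expR0 add0r mulr1.
rewrite mul1r mulr1 mulr0 sub0r expRD.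
have -> : pA * q * (expR s0 * expR (- th)) + pA * (1 - q) * expR (- th) =
  pA * ((1 + th) * expR (- th)) by rewrite /th; ring.
rewrite -[leRHS]mulr1; apply: ler_wpM2l; first by case/andP: pA01.
rewrite expRN ler_pdivrMr ?expR_gt0// mul1r; exact: expR_ge1Dx.
Qed.

Lemma chernoff_sum (bad : nat -> nat -> bool) (L : R) :
  (forall N, exists s, forall K, bad N K ->
     L <= s * K%:R - N%:R * (q * (expR s - 1))) ->
  \sum_b \sum_(c | bad (nb_true b) (nb_true c)) pattern_prob b c <= expR (- L).
Proof.
move=> /choice[s sP].
rewrite -[leRHS]mulr1; have := chernoff_mgf s.
move=> /(ler_wpM2l (expR_ge0 (- L))); apply: le_trans.
rewrite mulr_sumr; apply: ler_sum => b _; rewrite mulr_sumr.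
rewrite [leLHS]big_mkcond; apply: ler_sum => c _ /=.
case: ifPn => [badbc|_]; last first.
  by rewrite !mulr_ge0 ?expR_ge0// pattern_prob_ge0.
rewrite mulrCA -expRD -[leLHS]mulr1; apply: ler_wpM2l.
  exact: pattern_prob_ge0.
rewrite -[leLHS]expR0 ler_expR; have := sP _ _ badbc; lra.
Qed.

Definition lower_bad (L : R) N K :=
  K%:R < N%:R * q - Num.sqrt (2 * (N%:R * q) * L).

Definition upper_bad (L : R) N K :=
  N%:R * q + 3 * Num.sqrt (N%:R * q * L) + 3 * L < K%:R.

(** The tails are stated relative to the actual number of points in [A], so that
    they bound the deviation of the conditional frequency. *)
Lemma chernoff_lower (L : R) : 0 <= L ->
  \sum_b \sum_(c | lower_bad L (nb_true b) (nb_true c)) pattern_prob b c <= expR (- L).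
Proof.
move=> L0; apply: chernoff_sum => N; rewrite /lower_bad; set mu := N%:R * q.
have mu0 : 0 <= mu by rewrite mulr_ge0//; case/andP: q01.
(* the optimal exponent for a Gaussian tail of variance mu *)
pose u := Num.sqrt (2 * L / mu); exists (- u) => K Kbad.
have mup : 0 < mu.
  rewrite lt_neqAle mu0 andbT; apply/negP => /eqP m0.
  by move: Kbad; rewrite -m0 mulr0 mul0r sqrtr0 subr0 ltNge ler0n.
have -> : N%:R * (q * (expR (- u) - 1)) = mu * (expR (- u) - 1) by rewrite mulrA.
have u0 : 0 <= u by exact: sqrtr_ge0.
have h : 0 <= 2 * L / mu by apply: divr_ge0 => //; lra.
have u2 : mu * u ^+ 2 = 2 * L by rewrite sqr_sqrtr//; field; lra.
have uM : u * Num.sqrt (2 * mu * L) = 2 * L.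
  rewrite -sqrtrM//.
  have -> : 2 * L / mu * (2 * mu * L) = (2 * L) ^+ 2 by field; lra.
  by rewrite sqrtr_sqr ger0_norm// mulr_ge0.
have /(ler_wpM2l mu0) e := expRN_le_quadratic u0.
have : u * (mu - Num.sqrt (2 * mu * L)) >= u * K%:R by apply: ler_wpM2l => //; exact: ltW.
lra.
Qed.

Lemma chernoff_upper (L : R) : 0 < L ->
  \sum_b \sum_(c | upper_bad L (nb_true b) (nb_true c)) pattern_prob b c <= expR (- L).
Proof.
move=> L0; apply: chernoff_sum => N; rewrite /upper_bad; set mu := N%:R * q.
have mu0 : 0 <= mu by rewrite mulr_ge0//; case/andP: q01.
have E s : N%:R * (q * (expR s - 1)) = mu * (expR s - 1) by rewrite mulrA.
(* the exponent is capped at 1 / 2, the range of expR_le_quadratic *)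
have [muL|muL] := leP L mu; last first.
  exists (1 / 2) => K Kbad; rewrite E.
  have half : 0 <= (1 / 2 : R) <= 1 / 2 by rewrite lexx andbT divr_ge0.
  have /(ler_wpM2l mu0) e := expR_le_quadratic half.
  by have := sqrtr_ge0 (mu * L); lra.
have mup : 0 < mu by lra.
pose s := Num.sqrt (L / mu) / 2; exists s => K Kbad; rewrite E.
have h : 0 <= L / mu by rewrite divr_ge0// ltW.
have s0 : 0 <= s by rewrite divr_ge0// sqrtr_ge0.
have s2 : mu * s ^+ 2 = L / 4 by rewrite expr_div_n sqr_sqrtr//; field; lra.
have sh : s <= 1 / 2.
  rewrite ler_pdivrMr//; apply: sqrt_le_sqr; first lra.
  by rewrite ler_pdivrMr//; lra.
have sM : s * Num.sqrt (mu * L) = L / 2.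
  rewrite /s mulrAC -sqrtrM//.
  have -> : L / mu * (mu * L) = L ^+ 2 by field; lra.
  by rewrite sqrtr_sqr ger0_norm// ltW.
have := @expR_le_quadratic _ s; rewrite s0 sh => /(_ isT) /(ler_wpM2l mu0) e.
have : s * (mu + 3 * Num.sqrt (mu * L) + 3 * L) <= s * K%:R.
  by apply: ler_wpM2l => //; exact: ltW.
nra.
Qed.

End chernoff.

(** * The joint law of the training data, the test point and the randomization *)

Definition box {n : nat} {T : Type} (A : 'I_n -> set T) : set (n.-tuple T) :=
  [set z | forall i, A i (tnth z i)].

Lemma measurable_box {d : measure_display} {T : measurableType d} {n : nat}
    (A : 'I_n -> set T) :
  (forall i, measurable (A i)) -> measurable (box A).
Proof.
move=> mA; rewrite (_ : box A = \bigcap_i ((fun z => tnth z i) @^-1` A i)).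
  by apply: fin_bigcap_measurable => // i _; rewrite -[X in measurable X]setTI;
    exact: measurable_tnth.
by apply/seteqP; split=> z /= h i; [move=> _|]; apply: h.
Qed.

Section product_law.
Context {R : realType} {d n : nat} {dV : measure_display} {V : measurableType dV}.
Variables (nu : probability V R) (P : probability (datapt R d) R).
Context {dO : measure_display} {O : measurableType dO}.
Variables (Pr : probability O R).
Variables (Z : 'I_n.+1 -> {RV Pr >-> datapt R d}) (W : {RV Pr >-> V}).
Hypothesis iid : iid_sample nu P Z W.

Lemma measurable_training :
  measurable_fun [set: O] (training (fun i w => Z i w)).
Proof.
apply/measurable_fun_tnthP => i.
rewrite (_ : _ \o _ = Z (widen_ord (leqnSn n) i)) //.
by apply/funext => w /=; rewrite tnth_mktuple.
Qed.

Definition train_rv : {RV Pr >-> n.-tuple (datapt R d)} :=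
  HB.pack_for {mfun O >-> n.-tuple (datapt R d)} (training (fun i w => Z i w))
    (isMeasurableFun.Build _ _ _ _ _ measurable_training).

Lemma measurable_testX : measurable_fun [set: O] (testX (fun i w => Z i w)).
Proof. exact: (measurableT_comp measurable_fst). Qed.

Definition sample_rv (w : O) :=
  (training (fun i w => Z i w) w, (testX (fun i w => Z i w) w, W w)).

Lemma measurable_sample : measurable_fun [set: O] sample_rv.
Proof.
apply: measurable_fun_pair; first exact: measurable_training.
by apply: measurable_fun_pair => //; exact: measurable_testX.
Qed.

Definition sample_RV : {RV Pr >-> (n.-tuple (datapt R d) * (d.-tuple R * V))%type} :=
  HB.pack_for {mfun O >-> (n.-tuple (datapt R d) * (d.-tuple R * V))%type} sample_rv
    (isMeasurableFun.Build _ _ _ _ _ measurable_sample).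

Lemma sample_box (A : 'I_n -> set (datapt R d)) (B : set (d.-tuple R)) (C : set V) :
  (forall i, measurable (A i)) -> measurable B -> measurable C ->
  distribution Pr sample_RV (box A `*` (B `*` C)) =
  (\prod_(i < n) P (A i) * (marginalX P B * nu C))%E.
Proof.
move=> mA mB mC; have [hZ hW hI] := iid.
pose A' (i : 'I_n.+1) : set (datapt R d) :=
  if unlift ord_max i is Some j then A j else B `*` setT.
have A'w i : A' (widen_ord (leqnSn n) i) = A i.
  rewrite /A'; have -> : widen_ord (leqnSn n) i = lift ord_max i.
    by apply/val_inj; rewrite /= /bump leqNgt ltn_ord.
  by rewrite liftK.
have A'm : A' ord_max = B `*` setT by rewrite /A' unlift_none.
have mA' i : measurable (A' i).
  by rewrite /A'; case: unliftP => [j _|_] //; exact: measurableX.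
transitivity (Pr ((\bigcap_i (Z i @^-1` A' i)) `&` W @^-1` C)).
  rewrite /distribution /pushforward; congr (Pr _); apply/seteqP; split=> w /=.
    move=> [h1 [h2 h3]]; split=> // i _ /=.
    rewrite /A'; case: unliftP => [j ->|->] //.
      have := h1 j; rewrite tnth_mktuple /=.
      by congr (A j (Z _ w)); apply/val_inj; rewrite /= /bump leqNgt ltn_ord.
  move=> [h1 h2]; split; last first.
    by split=> //; have := h1 ord_max I; rewrite /= A'm => -[].
  by move=> i; have := h1 (widen_ord (leqnSn n) i) I; rewrite /= A'w tnth_mktuple.
rewrite hI// big_ord_recr /= -muleA; congr (_ * (_ * _))%E.
- by apply: eq_bigr => i _; rewrite A'w; exact: hZ.
- rewrite A'm; have := hZ ord_max (B `*` setT).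
  rewrite /distribution /pushforward => ->; last exact: measurableX.
  congr (P _); apply/seteqP; split=> z /=; tauto.
- exact: hW.
Qed.

Lemma training_box (A : 'I_n -> set (datapt R d)) : (forall i, measurable (A i)) ->
  distribution Pr train_rv (box A) = (\prod_(i < n) P (A i))%E.
Proof.
move=> mA; have := sample_box mA (measurableT : measurable [set: d.-tuple R])
  (measurableT : measurable [set: V]).
rewrite !probability_setT !mule1 => <-.
rewrite /distribution /pushforward; congr (Pr _); apply/seteqP; split=> w //=.
by move=> [].
Qed.

Let boxes : set (set (n.-tuple (datapt R d) * (d.-tuple R * V))) :=
  [set E | exists A B C, [/\ forall i, measurable (A i), measurable B, measurable C &
     E = box A `*` (B `*` C)]].

Definition test_law : probability (d.-tuple R * V)%type R := (marginalX P \x nu)%E.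

(** Products of boxes generate the sigma-algebra and are stable by
    intersection, so the independence of [sample_box] determines the law. *)
Lemma sample_law E : measurable E ->
  distribution Pr sample_RV E =
  (distribution Pr train_rv \x test_law)%E E.
Proof.
move=> mE.
pose m1 : {measure set _ -> \bar R} := distribution Pr sample_RV.
pose m2 : {measure set _ -> \bar R} :=
  (distribution Pr train_rv \x test_law)%E.
rewrite -[LHS]/(m1 E) -[RHS]/(m2 E).
apply: (@g_sigma_algebra_measure_unique _ _ _ boxes _ (fun=> setT)).
- move=> _ [A [B [C [mA mB mC ->]]]].
  by apply: measurableX; [exact: measurable_box|exact: measurableX].
- move=> _; exists (fun=> setT), setT, setT; split=> //.
  by apply/seteqP; split.
- by apply/seteqP; split=> // x _; exists 0.
- move=> _ _ [A [B [C [mA mB mC ->]]]] [A' [B' [C' [mA' mB' mC' ->]]]].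
  exists (fun i => A i `&` A' i), (B `&` B'), (C `&` C'); split.
  + by move=> i; exact: measurableI.
  + exact: measurableI.
  + exact: measurableI.
  + apply/seteqP; split=> -[z [x v]] /=.
      move=> [[a [b c]] [a' [b' c']]].
      exact: (conj (fun i => conj (a i) (a' i)) (conj (conj b b') (conj c c'))).
    move=> [a [[b b'] [c c']]].
    exact: (conj (conj (fun i => proj1 (a i)) (conj b c))
                 (conj (fun i => proj2 (a i)) (conj b' c'))).
- move=> _ [A [B [C [mA mB mC ->]]]].
  have mBC : measurable (B `*` C) by exact: measurableX.
  have mbA := measurable_box mA.
  rewrite [LHS](sample_box mA mB mC) [RHS]product_measure1E//.
  by rewrite -training_box//; congr (_ * _)%E; rewrite /test_law [RHS]product_measure1E.
- move=> k.
  by rewrite [X in (X < _)%E](@probability_setT _ _ _ (distribution Pr sample_RV)) ltry.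
(* the identity map is measurable from the sigma-algebra generated by the boxes,
   since its coordinates are *)
pose GT := g_sigma_algebraType boxes.
have inG (A : 'I_n -> set (datapt R d)) B C : (forall i, measurable (A i)) ->
    measurable B -> measurable C -> <<s boxes >> (box A `*` (B `*` C)).
  by move=> *; apply: sub_sigma_algebra; exists A, B, C; split.
have mid : measurable_fun [set: GT] (id : GT -> n.-tuple (datapt R d) * (d.-tuple R * V)).
  apply/measurable_fun_pairP; split; [|apply/measurable_fun_pairP; split].
  - apply/measurable_fun_tnthP => i _ Y mY; rewrite setTI.
    rewrite (_ : _ @^-1` Y = box (fun j => if j == i then Y else setT) `*` (setT `*` setT)).
      by apply: inG => // j; case: ifPn.
    apply/seteqP; split=> -[z [x v]] /=.
      by move=> Yz; split=> // j; case: eqP => [->|].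
    by move=> [/(_ i)]; rewrite eqxx.
  - move=> _ Y mY; rewrite setTI.
    rewrite (_ : _ @^-1` Y = box (fun j => setT) `*` (Y `*` setT)); first exact: inG.
    by apply/seteqP; split=> -[z [x v]] //= -[_ []].
  - move=> _ Y mY; rewrite setTI.
    rewrite (_ : _ @^-1` Y = box (fun j => setT) `*` (setT `*` Y)); first exact: inG.
    by apply/seteqP; split=> -[z [x v]] //= -[_ []].
by have := mid measurableT _ mE; rewrite setTI.
Qed.

Lemma sample_integral (h : n.-tuple (datapt R d) * (d.-tuple R * V) -> \bar R) :
  measurable_fun setT h -> (forall y, 0 <= h y)%E ->
  (\int[Pr]_w h (sample_rv w) =
   \int[distribution Pr train_rv]_z \int[marginalX P]_x \int[nu]_v h (z, (x, v)))%E.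
Proof.
move=> mh h0.
rewrite -(@ge0_integral_distribution _ _ _ _ _ Pr sample_RV)//.
transitivity (\int[distribution Pr train_rv \x test_law]_y h y)%E.
  by apply: eq_measure_integral => E mE _; exact: sample_law.
rewrite fubini_tonelli1//; apply: eq_integral => z _.
rewrite /fubini_F fubini_tonelli1//.
exact: (measurableT_comp mh (pair1_measurable z)).
Qed.

End product_law.

(** * From the law of a sample to tail bounds for counts *)

Section union_bound.
Context {d : measure_display} {T : measurableType d} {R : realType}.
Variable mu : {measure set T -> \bar R}.

Lemma measure_union_le (I : finType) (Q : pred I) (F : I -> set T) :
  (forall i, measurable (F i)) ->
  (mu (\bigcup_(i in [set i | Q i]) F i) <= \sum_(i | Q i) mu (F i))%E.
Proof.
move=> mF; rewrite (_ : \bigcup_(i in _) _ = \big[setU/set0]_(i | Q i) F i); last first.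
  rewrite -bigcup_seq_cond; congr bigcup; apply/seteqP; split=> i /=.
    by rewrite mem_index_enum.
  by move=> /andP[].
pose K (A : set T) (x : \bar R) := measurable A /\ (mu A <= x)%E.
suff : K (\big[setU/set0]_(i | Q i) F i) (\sum_(i | Q i) mu (F i))%E by case.
apply: (big_ind2 K) => [|A x B y [mA hA] [mB hB]|i _]; split=> //.
- by rewrite measure0.
- exact: measurableU.
- by apply: le_trans (measureU2 _ _ _) _ => //; exact: leeD.
Qed.

End union_bound.

Section tails.
Context {d : measure_display} {T : measurableType d} {R : realType} {n : nat}.
Variables (P : probability T R) (nu : probability (n.-tuple T) R).
Hypothesis nu_box : forall A : 'I_n -> set T, (forall i, measurable (A i)) ->
  nu (box A) = (\prod_(i < n) P (A i))%E.
Variables (A B : set T) (q : R).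
Hypotheses (mA : measurable A) (mB : measurable B) (BA : B `<=` A)
  (q01 : 0 <= q <= 1) (qB : P B = ((fine (P A)) * q)%:E).

Definition hits (C : set T) (z : n.-tuple T) : R := \sum_(i < n) \1_C (tnth z i).

Let pA := fine (P A).

Let pAE : P A = pA%:E.
Proof. by rewrite fineK// fin_num_measure. Qed.

Lemma prob_fine01 (C : set T) : measurable C -> 0 <= fine (P C) <= 1.
Proof.
move=> mC; have h : P C \is a fin_num by exact: fin_num_measure.
by rewrite -!lee_fin fineK// measure_ge0 probability_le1.
Qed.

Let cell_of (x y : bool) : set T :=
  if x then (if y then B else A `\` B) else (if y then set0 else ~` A).

Let measurable_cell_of x y : measurable (cell_of x y).
Proof. by case: x; case: y => //=; [exact: measurableD|exact: measurableC]. Qed.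

Let prob_cell_of x y : P (cell_of x y) = (pattern_weight pA q x y)%:E.
Proof.
case: x; case: y => //=.
- rewrite measureD//; last by rewrite -ge0_fin_numE ?measure_ge0// fin_num_measure.
  by rewrite setIidr// [X in (_ - X)%E]qB [X in (X - _)%E]pAE -EFinB mulrBr mulr1.
- by rewrite [LHS]measure0.
- by rewrite [LHS]probability_setC// [P A]pAE.
Qed.

(** An event determined by the two counts is covered by boxes, one for each pair
    of patterns, whose probabilities are the [pattern_prob]. *)
Lemma pattern_tail (bad : nat -> nat -> bool) (E : set (n.-tuple T)) (e : R) :
  measurable E ->
  (forall z, E z -> bad (\sum_(i < n) (tnth z i \in A))%N
    (\sum_(i < n) (tnth z i \in B))%N) ->
  \sum_(b : {ffun 'I_n -> bool})
  \sum_(c : {ffun 'I_n -> bool} | bad (nb_true b) (nb_true c))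
    pattern_prob pA q b c <= e ->
  (nu E <= e%:E)%E.
Proof.
move=> mE Ebad he.
pose bx (p : {ffun 'I_n -> bool} * {ffun 'I_n -> bool}) :=
  box (fun i => cell_of (p.1 i) (p.2 i)).
have mbx p : measurable (bx p) by apply: measurable_box => i; exact: measurable_cell_of.
have sub : E `<=` \bigcup_(p in [set p | bad (nb_true p.1) (nb_true p.2)]) bx p.
  move=> z /Ebad Ez.
  exists ([ffun i => tnth z i \in A], [ffun i => tnth z i \in B]).
    rewrite /= /nb_true; under eq_bigr do rewrite ffunE.
    by under [X in bad _ X]eq_bigr do rewrite ffunE.
  move=> i; rewrite /= !ffunE /cell_of.
  case: ifPn => [|]; rewrite ?inE ?notin_setE => zA;
    case: ifPn; rewrite ?inE ?notin_setE => // zB.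
  exact/zA/BA.
have mU : measurable (\bigcup_(p in [set p | bad (nb_true p.1) (nb_true p.2)]) bx p).
  by apply: fin_bigcup_measurable => // p _; exact: mbx.
apply: (le_trans (le_measure nu _ _ sub)); rewrite ?inE//.
apply: (le_trans (measure_union_le nu (fun p => bad (nb_true p.1) (nb_true p.2)) mbx)).
rewrite (eq_bigr (fun p => (pattern_prob pA q p.1 p.2)%:E)) => [|p _]; last first.
  rewrite [LHS](nu_box (fun i => measurable_cell_of (p.1 i) (p.2 i))).
  rewrite /pattern_prob -prodEFin.
  by apply: eq_bigr => i _; rewrite [LHS]prob_cell_of.
rewrite sumEFin lee_fin; apply: le_trans he; rewrite pair_big_dep.
exact: lexx.
Qed.

Lemma hitsE (C : set T) z : hits C z = (\sum_(i < n) (tnth z i \in C))%:R.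
Proof. by rewrite /hits natr_sum; apply: eq_bigr => i _; rewrite indicE. Qed.

Lemma measurable_hits (C : set T) : measurable C -> measurable_fun setT (hits C).
Proof.
move=> mC; apply: measurable_sum => i.
apply: measurableT_comp; last exact: measurable_tnth.
exact: measurable_indic.
Qed.

Lemma measurable_lower_event (L : R) :
  measurable [set z | hits B z < hits A z * q - Num.sqrt (2 * (hits A z * q) * L)].
Proof.
have mAq : measurable_fun setT (fun z => hits A z * q).
  by apply: measurable_funM => //; exact: measurable_hits.
have mf : measurable_fun setT (fun z =>
    hits B z < hits A z * q - Num.sqrt (2 * (hits A z * q) * L)).
  apply: measurable_fun_ltr; first exact: measurable_hits.
  apply: measurable_funB => //; apply: (measurableT_comp measurable_sqrt).
  by apply: measurable_funM => //; apply: measurable_funM.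
by rewrite -[X in measurable X]setTI; exact: (mf measurableT [set true]).
Qed.

Lemma measurable_upper_event (L : R) :
  measurable [set z | hits A z * q + 3 * Num.sqrt (hits A z * q * L) + 3 * L < hits B z].
Proof.
have mAq : measurable_fun setT (fun z => hits A z * q).
  by apply: measurable_funM => //; exact: measurable_hits.
have mf : measurable_fun setT (fun z =>
    hits A z * q + 3 * Num.sqrt (hits A z * q * L) + 3 * L < hits B z).
  apply: measurable_fun_ltr; last exact: measurable_hits.
  apply: measurable_funD => //; apply: measurable_funD => //.
  apply: measurable_funM => //; apply: (measurableT_comp measurable_sqrt).
  by apply: measurable_funM => //; apply: measurable_funM.
by rewrite -[X in measurable X]setTI; exact: (mf measurableT [set true]).
Qed.

Lemma lower_tail (L : R) : 0 <= L ->
  (nu [set z | (hits B z < hits A z * q - Num.sqrt (2 * (hits A z * q) * L))%R]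
   <= (expR (- L)%R)%:E)%E.
Proof.
move=> L0; apply: (@pattern_tail (lower_bad q L)); first exact: measurable_lower_event.
- by move=> z /=; rewrite /lower_bad -!hitsE.
- by apply: chernoff_lower => //; exact: prob_fine01.
Qed.

Lemma upper_tail (L : R) : 0 < L ->
  (nu [set z | (hits A z * q + 3 * Num.sqrt (hits A z * q * L) + 3 * L < hits B z)%R]
   <= (expR (- L)%R)%:E)%E.
Proof.
move=> L0; apply: (@pattern_tail (upper_bad q L)); first exact: measurable_upper_event.
- by move=> z /=; rewrite /upper_bad -!hitsE.
- by apply: chernoff_upper => //; exact: prob_fine01.
Qed.

End tails.

(** * Inverting the tail bounds *)

Section estimates.
Context {R : realType}.
Implicit Types x y r l : R.

(** In the tail bounds the deviation of the estimate [y] from the unknown [x] is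
    measured on the scale of [x]. Completing the square moves it to the
    observable scale of [y]. *)
Lemma self_bound_sqrt x y r : 0 <= x -> 0 <= y -> 0 <= r ->
  x <= y + Num.sqrt (x * r) -> Num.sqrt x <= Num.sqrt y + Num.sqrt r.
Proof.
move=> x0 y0 r0; rewrite sqrtrM//.
have := sqr_sqrtr x0; have := sqr_sqrtr y0.
have := sqrtr_ge0 x; have := sqrtr_ge0 y; have := sqrtr_ge0 r.
move: (Num.sqrt x) (Num.sqrt y) (Num.sqrt r) => w v s s0 v0 w0 <- <- h.
rewrite leNgt; apply/negP => hw; nra.
Qed.

Lemma self_bound x y r : 0 <= x -> 0 <= y -> 0 <= r ->
  x <= y + Num.sqrt (x * r) -> x <= y + Num.sqrt (y * r) + r.
Proof.
move=> x0 y0 r0 h; have := self_bound_sqrt x0 y0 r0 h.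
move: h; rewrite !sqrtrM//.
have := sqr_sqrtr r0.
have := sqrtr_ge0 x; have := sqrtr_ge0 y; have := sqrtr_ge0 r.
move: (Num.sqrt x) (Num.sqrt y) (Num.sqrt r) => w v s s0 v0 w0 <- h h'; nra.
Qed.

Lemma sqrt_widen y r : 0 <= y -> 0 <= r ->
  Num.sqrt (y + Num.sqrt (y * r) + r) <= Num.sqrt y + Num.sqrt r.
Proof.
move=> y0 r0; apply: sqrt_le_sqr; first by rewrite addr_ge0 ?sqrtr_ge0.
rewrite sqrtrM//; have := sqr_sqrtr y0; have := sqr_sqrtr r0.
have := sqrtr_ge0 y; have := sqrtr_ge0 r.
move: (Num.sqrt y) (Num.sqrt r) => v s s0 v0 <- <-; nra.
Qed.

Lemma lower_tail_bound (N K q L : R) : 0 < N -> 0 <= K -> 0 <= q -> 0 <= L ->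
  N * q - Num.sqrt (2 * (N * q) * L) <= K ->
  q <= K / N + Num.sqrt (K / N * (2 * L / N)) + 2 * L / N.
Proof.
move=> N0 K0 q0 L0 h; apply: self_bound => //; try by rewrite divr_ge0 ?mulr_ge0// ltW.
have -> : q * (2 * L / N) = 2 * (N * q) * L / N ^+ 2 by field; lra.
rewrite sqrtrM; last by rewrite !mulr_ge0 // ltW.
rewrite sqrtrV; last exact: sqr_ge0.
rewrite sqrtr_sqr gtr0_norm// -mulrDl ler_pdivlMr//; lra.
Qed.

Lemma upper_tail_bound (N K q L : R) : 0 < N -> 0 <= K -> 0 <= q -> 0 <= L ->
  K <= N * q + 3 * Num.sqrt (N * q * L) + 3 * L ->
  Num.sqrt (K / N) <= Num.sqrt q + 2 * Num.sqrt (L / N).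
Proof.
move=> N0 K0 q0 L0 h.
apply: sqrt_le_sqr; first by rewrite addr_ge0 ?mulr_ge0 ?sqrtr_ge0.
rewrite ler_pdivrMr//; apply: (le_trans h).
have LN : 0 <= L / N by rewrite divr_ge0// ltW.
have -> : N * q * L = N ^+ 2 * (q * (L / N)) by field; lra.
rewrite sqrtrM ?sqr_ge0// sqrtr_sqr gtr0_norm// sqrtrM//.
have Lq : L = N * (L / N) by field; lra.
rewrite [in 3 * L]Lq.
have := sqr_sqrtr LN; have := sqr_sqrtr q0.
have := sqrtr_ge0 q; have := sqrtr_ge0 (L / N).
move: (Num.sqrt q) (Num.sqrt (L / N)) => v s s0 v0 <- <-.
have -> : N * v ^+ 2 + 3 * (N * (v * s)) + 3 * (N * s ^+ 2) =
  (v ^+ 2 + 3 * (v * s) + 3 * s ^+ 2) * N by ring.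
apply: ler_wpM2r; first exact: ltW.
nra.
Qed.

(** Cauchy-Schwarz, in the form of the tangent lines of the square root at
    [1 / M]. *)
Lemma sum_sqrt_le (M : nat) (p : 'I_M -> R) : (forall m, 0 <= p m) ->
  \sum_m p m = 1 -> \sum_m Num.sqrt (p m) <= Num.sqrt M%:R.
Proof.
move=> p0 p1.
have M0 : (0 < M)%N.
  case: M p p0 p1 => // p _; rewrite big_ord0 => /eqP.
  by rewrite eq_sym oner_eq0.
set s := Num.sqrt M%:R; have s0 : 0 < s by rewrite sqrtr_gt0 ltr0n.
have s2 : s ^+ 2 = M%:R by rewrite sqr_sqrtr.
apply: (@le_trans _ _ (\sum_m (p m * (s / 2) + (2 * s)^-1))).
  apply: ler_sum => m _; have := sqr_sqrtr (p0 m).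
  move: (Num.sqrt (p m)) => v <-.
  have : 0 <= (v * s - 1) ^+ 2 / (2 * s) by rewrite divr_ge0 ?sqr_ge0//; lra.
  have -> : (v * s - 1) ^+ 2 / (2 * s) = v ^+ 2 * (s / 2) + (2 * s)^-1 - v by field; lra.
  lra.
rewrite big_split /= -mulr_suml p1 sumr_const card_ord -[X in _ + X]mulr_natl -s2.
rewrite le_eqVlt; apply/orP; left; apply/eqP; field; lra.
Qed.

Lemma ln2_ge : 1 / 2 <= ln 2 :> R.
Proof.
rewrite -ler_expR lnK ?posrE//.
have := expR_ge1Dx (- (1 / 2) : R); rewrite expRN => h.
have e0 := expR_gt0 (1 / 2 : R).
by rewrite -[leRHS]invrK -[leLHS]invrK lef_pV2 ?posrE ?invr_gt0//; lra.
Qed.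

End estimates.

(** * Samples on which the estimates are accurate *)

Lemma cell_index_eq {R : realType} {d M : nat} (X : mpartition R d M) m x :
  cell X m x -> cell_index X x = m.
Proof.
move=> xm; have dX := @cell_disjoint _ _ _ X.
by apply: dX => //; exists x; split=> //; exact: cell_indexP.
Qed.

Lemma cell_indicator {R : realType} {d M : nat} (X : mpartition R d M)
    (c : 'I_M -> R) x :
  c (cell_index X x) = \sum_m c m * \1_(cell X m) x.
Proof.
rewrite (bigD1 (cell_index X x))//= big1 => [|m mi].
  by rewrite indicE mem_set ?mulr1 ?addr0//; exact: cell_indexP.
rewrite indicE memNset ?mulr0// => xm; move/eqP: mi; apply.
by rewrite (cell_index_eq xm).
Qed.

Section good_samples.
Context {R : realType} {d M n : nat}.
Variables (X : mpartition R d M) (alpha : R).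
Hypotheses (n2 : (2 <= n)%N) (M1 : (1 <= M)%N) (alpha01 : 0 < alpha <= 1).
Implicit Types (z : n.-tuple (datapt R d)) (m : 'I_M).

Local Notation L := (lg (M := M) (n := n) alpha).
Let nR : R := n%:R.

Definition cell_pts m : set (datapt R d) := cell X m `*` [set: bool].
Definition label_pts m (y : bool) : set (datapt R d) := cell X m `*` [set y].

Lemma n_gt0 : 0 < nR.
Proof. by rewrite ltr0n; apply: leq_trans n2. Qed.

(** From [4 * M * n >= 8] and [ln 2 >= 1 / 2]. The margin above 1 matters for
    [n = 2] in the coverage guarantee. *)
Lemma lg_ge : 3 / 2 <= L.
Proof.
have [a0 a1] := andP alpha01.
have h8 : 2 ^+ 3 <= (4 * M * n)%:R / alpha.
  rewrite ler_pdivlMr//; apply: (@le_trans _ _ (2 ^+ 3)).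
    by rewrite ler_piMr// exprn_ge0.
  rewrite -natrX ler_nat -[(2 ^ 3)%N]/(4 * 2)%N -mulnA leq_mul2l /=.
  by apply: (leq_trans n2); rewrite leq_pmull.
apply: (@le_trans _ _ (ln (2 ^+ 3 : R))).
  by rewrite lnXn//; have := @ln2_ge R; lra.
have p8 : 0 < 2 ^+ 3 :> R by rewrite exprn_gt0.
by rewrite ler_ln ?posrE//; exact: lt_le_trans h8.
Qed.

Lemma lg_ge1 : 1 <= L. Proof. by have := lg_ge; lra. Qed.

Lemma lg_ge0 : 0 <= L. Proof. by have := lg_ge1; lra. Qed.

Lemma phatE z m : phat X z m = hits (R := R) (cell_pts m) z / nR.
Proof.
rewrite /phat /hits; congr (_ / _); apply: eq_bigr => i _.
rewrite !indicE; congr (_%:R); congr nat_of_bool.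
by apply/idP/idP => /set_mem h; apply/mem_set; [split|case: h].
Qed.

Lemma hits_ge0 (C : set (datapt R d)) z : 0 <= hits (R := R) C z.
Proof. by rewrite hitsE. Qed.

Lemma hits_labels z m :
  hits (R := R) (cell_pts m) z = hits (label_pts m true) z + hits (label_pts m false) z.
Proof.
rewrite /hits -big_split; apply: eq_bigr => i _ /=; rewrite !indicE.
case: (tnth z i) => x y.
have memE (B : set bool) : ((x, y) \in cell X m `*` B) = (x \in cell X m) && (y \in B).
  apply/idP/andP => [/set_mem[xm yB]|[/set_mem xm /set_mem yB]].
    by split; apply/mem_set.
  exact/mem_set.
rewrite /cell_pts /label_pts !memE; case: (x \in _) => /=; rewrite ?addr0//.
have -> : (y \in [set: bool]) by rewrite inE.
clear memE; case: y => /=; first by rewrite mem_set// memNset//= addr0.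
by rewrite memNset// mem_set//= add0r.
Qed.

Lemma sum_phat z : \sum_m phat X z m = 1.
Proof.
rewrite /phat -mulr_suml exchange_big /=.
rewrite (eq_bigr (fun=> 1)) => [|i _].
  rewrite sumr_const card_ord mulfV// gt_eqF//; exact: n_gt0.
have := cell_indicator X (fun=> 1) (tnth z i).1.
by under [in RHS]eq_bigr do rewrite mul1r.
Qed.

Lemma phat_ge0 z m : 0 <= phat X z m.
Proof. by rewrite phatE divr_ge0 ?hits_ge0// ltW ?n_gt0. Qed.

Lemma n_phat z m : nR * phat X z m = hits (cell_pts m) z.
Proof. by rewrite phatE mulrC mulfVK// gt_eqF// n_gt0. Qed.

Lemma pihatE z m : 0 < hits (R := R) (cell_pts m) z ->
  pihat X z m = hits (label_pts m true) z / hits (cell_pts m) z.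
Proof.
move=> N0; rewrite /pihat -/nR n_phat phatE mulf_eq0 invr_eq0.
by rewrite (gt_eqF N0) (gt_eqF n_gt0).
Qed.

Lemma onem_pihatE z m : 0 < hits (R := R) (cell_pts m) z ->
  1 - pihat X z m = hits (label_pts m false) z / hits (cell_pts m) z.
Proof.
move=> N0; rewrite pihatE//; move: N0; rewrite hits_labels => N0.
by field; lra.
Qed.

Lemma pihat_bounds z m : 0 <= pihat X z m <= 1.
Proof.
have := hits_ge0 (cell_pts m) z; rewrite le_eqVlt => /orP[/eqP N0|N0].
  by rewrite /pihat phatE -N0 mul0r eqxx; lra.
have h0 : 0 <= 1 - pihat X z m by rewrite onem_pihatE// divr_ge0 ?hits_ge0.
have h1 : 0 <= pihat X z m by rewrite pihatE// divr_ge0 ?hits_ge0.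
lra.
Qed.

Local Notation rad z m := (2 * L / hits (cell_pts m) z).

Lemma pitildeE z m : pitilde X alpha z m = if pihat X z m <= 1 / 2
  then Num.min (1 / 2) (pihat X z m + Num.sqrt (pihat X z m * rad z m) + rad z m)
  else Num.max (1 / 2) (pihat X z m - Num.sqrt ((1 - pihat X z m) * rad z m) - rad z m).
Proof. by rewrite /pitilde -/nR n_phat. Qed.

Lemma rad_ge0 z m : 0 <= rad z m.
Proof. by rewrite divr_ge0 ?hits_ge0// mulr_ge0// lg_ge0. Qed.

Lemma empty_cell_pitilde z m : hits (R := R) (cell_pts m) z = 0 -> pitilde X alpha z m = 1 / 2.
Proof.
move=> N0; have ph : pihat X z m = 1 / 2 by rewrite /pihat phatE N0 mul0r eqxx.
by rewrite pitildeE ph N0 invr0 !mulr0 sqrtr0 !addr0 lexx minxx.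
Qed.

(** The bounds are strict, which excludes the discontinuous level functions at
    [t = 0] and [t = 1]. *)
Lemma pitilde_bounds z m : 0 < pitilde X alpha z m < 1.
Proof.
have := hits_ge0 (cell_pts m) z; rewrite le_eqVlt => /orP[/eqP N0|N0].
  by rewrite empty_cell_pitilde//; lra.
rewrite pitildeE; have ph := pihat_bounds z m.
have r0 : 0 < rad z m by rewrite divr_gt0// mulr_gt0//; have := lg_ge1; lra.
move: (rad z m) (pihat X z m) r0 ph => r x r0 ph.
have := sqrtr_ge0 (x * r); have := sqrtr_ge0 ((1 - x) * r).
case: ifPn => hx; rewrite ?lt_min ?gt_min ?lt_max ?gt_max => *;
  apply/andP; split; try (apply/andP; split); try (apply/orP; left); lra.
Qed.

(** The correction of [pihat] is additive on the scale of square roots: the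
    displacement in the definition of [pitilde] is dominated by the one that
    squaring [Num.sqrt (pihat X z m) + Num.sqrt (rad z m)] produces. *)
Lemma sqrt_end_dist_pitilde z m :
  Num.sqrt (end_dist (pitilde X alpha z m)) <=
  Num.sqrt (end_dist (pihat X z m)) + Num.sqrt (rad z m).
Proof.
rewrite pitildeE; have ph := pihat_bounds z m; have r0 := rad_ge0 z m.
move: (rad z m) (pihat X z m) r0 ph => r x r0 ph.
case: ifPn => hx.
  have -> : end_dist x = x by rewrite /end_dist min_l//; lra.
  apply: le_trans (sqrt_widen _ _) => //; last by case/andP: ph.
  apply: ler_wsqrtr; rewrite /end_dist ge_min; apply/orP; left.
  by rewrite ge_min lexx orbT.
have -> : end_dist x = 1 - x by rewrite /end_dist min_r//; lra.
apply: le_trans (sqrt_widen _ _) => //; last by lra.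
apply: ler_wsqrtr; rewrite /end_dist ge_min; apply/orP; right.
rewrite lerBlDr -lerBlDl le_max; apply/orP; right; lra.
Qed.

Variables (p pi : 'I_M -> R).
Hypotheses (p01 : forall m, 0 <= p m <= 1) (pi01 : forall m, 0 <= pi m <= 1).

Definition good_mass z m :=
  nR * p m - Num.sqrt (2 * (nR * p m) * L) <= hits (cell_pts m) z.

Definition label_mean m (y : bool) : R := if y then pi m else 1 - pi m.

Definition good_lower z m y :=
  hits (cell_pts m) z * label_mean m y
  - Num.sqrt (2 * (hits (cell_pts m) z * label_mean m y) * L)
    <= hits (label_pts m y) z.

Definition good_upper z m y :=
  hits (label_pts m y) z <=
  hits (cell_pts m) z * label_mean m y
  + 3 * Num.sqrt (hits (cell_pts m) z * label_mean m y * L) + 3 * L.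

Lemma label_mean_ge0 m y : 0 <= label_mean m y.
Proof. by have := pi01 m; rewrite /label_mean; case: y; lra. Qed.

Lemma good_mass_le z m : good_mass z m ->
  p m <= phat X z m + Num.sqrt (phat X z m * (2 * L / nR)) + 2 * L / nR.
Proof.
move=> h; have := lower_tail_bound n_gt0 (hits_ge0 (cell_pts m) z) _ lg_ge0 h.
by rewrite -phatE; apply; case/andP: (p01 m).
Qed.

(** The constant 3 in [ptilde], instead of the 2 that the tail bound requires,
    leaves a slack of [L / n], which pays for the samples that are not good. *)
Lemma good_mass_ptilde z m : good_mass z m -> p m + L / nR <= ptilde X alpha z m.
Proof.
move=> /good_mass_le h; rewrite /ptilde -/nR.
have L0 : 0 <= L / nR by rewrite divr_ge0 ?lg_ge0// ltW// n_gt0.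
have : Num.sqrt (phat X z m * (2 * L / nR)) <= Num.sqrt (phat X z m * (3 * L / nR)).
  by apply: ler_wsqrtr; apply: ler_wpM2l; [exact: phat_ge0|lra].
lra.
Qed.

Lemma good_mass_crude z m : good_mass z m -> p m <= 2 * phat X z m + 3 * (L / nR).
Proof.
move=> /good_mass_le h; apply: (le_trans h).
have L0 : 0 <= L / nR by rewrite divr_ge0 ?lg_ge0// ltW// n_gt0.
rewrite -mulrA.
have ph := phat_ge0 z m.
have : Num.sqrt (phat X z m * (2 * (L / nR))) <= phat X z m + L / nR.
  apply: sqrt_le_sqr; first lra.
  by have := sqr_ge0 (phat X z m); have := sqr_ge0 (L / nR); rewrite !expr2; lra.
lra.
Qed.

(** The displacement of the estimate towards 1/2 exceeds its error in the
    opposite direction, and stops at 1/2. *)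
Lemma pitilde_side z m : good_lower z m true -> good_lower z m false ->
  (pitilde X alpha z m <= 1 / 2 /\ pi m <= pitilde X alpha z m) \/
  (1 / 2 <= pitilde X alpha z m /\ pitilde X alpha z m <= pi m) \/
  pitilde X alpha z m = 1 / 2.
Proof.
move=> h1 h0.
have := hits_ge0 (cell_pts m) z; rewrite le_eqVlt => /orP[/eqP N0|N0].
  by right; right; rewrite empty_cell_pitilde.
have := lower_tail_bound N0 (hits_ge0 _ z) (label_mean_ge0 m true) lg_ge0 h1.
have := lower_tail_bound N0 (hits_ge0 _ z) (label_mean_ge0 m false) lg_ge0 h0.
rewrite -onem_pihatE// -pihatE// pitildeE /label_mean => {}h0 {}h1.
case: ifPn => hx.
  rewrite /Num.min; case: ifPn => hm; first by right; right.
  by left; split=> //; lra.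
rewrite /Num.max; case: ifPn => hm; last by right; right.
right; left; lra.
Qed.

Lemma sqrt_end_dist_pihat z m : 0 < hits (R := R) (cell_pts m) z ->
  good_upper z m true -> good_upper z m false ->
  Num.sqrt (end_dist (pihat X z m)) <=
  Num.sqrt (end_dist (pi m)) + 2 * Num.sqrt (L / hits (cell_pts m) z).
Proof.
move=> N0 h1 h0.
have := upper_tail_bound N0 (hits_ge0 _ z) (label_mean_ge0 m true) lg_ge0 h1.
have := upper_tail_bound N0 (hits_ge0 _ z) (label_mean_ge0 m false) lg_ge0 h0.
rewrite -onem_pihatE// -pihatE// /label_mean => {}h0 {}h1.
have [hp|hp] := leP (pi m) (1 / 2).
  have -> : end_dist (pi m) = pi m by rewrite /end_dist min_l//; lra.
  by apply: le_trans h1; apply: ler_wsqrtr; rewrite ge_min lexx.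
have -> : end_dist (pi m) = 1 - pi m by rewrite /end_dist min_r//; lra.
by apply: le_trans h0; apply: ler_wsqrtr; rewrite ge_min lexx orbT.
Qed.

(** With [N] points in the cell, [Num.sqrt (end_dist _)] is estimated up to
    [4 * Num.sqrt (L / N)]; multiplied by the mass of the cell, of order
    [N / n], this is of order [Num.sqrt (phat * L / n)]. The mass
    that [phat] misses is of order [L / n], and there the trivial bound 1 on
    the difference suffices. *)
Lemma pen_length_error z m l : 0 <= l -> l * alpha <= 1 ->
  good_mass z m -> good_upper z m true -> good_upper z m false ->
  p m * (pen_length l (pitilde X alpha z m) - pen_length l (pi m)) <=
  12 * Num.sqrt (phat X z m * (L / (alpha * nR))) + 3 * (L / nR).
Proof.
move=> l0 la hm h1 h0; have [a0 a1] := andP alpha01.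
have hp := good_mass_crude hm; have /andP[pm0 _] := p01 m.
have t01 : 0 <= pitilde X alpha z m <= 1 by have := pitilde_bounds z m; lra.
have L0 := lg_ge0; have n0 := n_gt0.
have Ln0 : 0 <= L / nR by rewrite divr_ge0// ltW.
set v := pen_length l _ - pen_length l _.
have v1 : v <= 1.
  have := pen_length_bounds (pitilde X alpha z m) l0; have := pen_length_bounds (pi m) l0.
  by rewrite /v; lra.
have := sqrtr_ge0 (phat X z m * (L / (alpha * nR))) => sq0.
have [v0|v0] := leP v 0.
  have : p m * v <= 0 by rewrite mulr_ge0_le0.
  lra.
have := hits_ge0 (cell_pts m) z; rewrite le_eqVlt => /orP[/eqP N0|N0].
  have : p m * v <= p m by rewrite ler_piMr.
  move: hp; rewrite {1}phatE -N0 mul0r mulr0 add0r; lra.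
set N := hits _ _ in N0.
have LN0 : 0 <= L / N by rewrite divr_ge0// ltW.
have dif : v <= Num.sqrt (2 * l) * (4 * Num.sqrt (L / N)).
  have := pen_length_diff_le l0 t01 (pi01 m); rewrite -/v.
  have sM t : Num.sqrt (2 * l * t) = Num.sqrt (2 * l) * Num.sqrt t.
    by rewrite sqrtrM// mulr_ge0.
  rewrite !sM -mulrBr => hv.
  have s2l : 0 <= Num.sqrt (2 * l) by exact: sqrtr_ge0.
  have ht : Num.sqrt (end_dist (pitilde X alpha z m)) - Num.sqrt (end_dist (pi m)) <=
            4 * Num.sqrt (L / N).
    have := sqrt_end_dist_pitilde z m; have := sqrt_end_dist_pihat N0 h1 h0; rewrite -/N.
    have : Num.sqrt (2 * L / N) <= 2 * Num.sqrt (L / N).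
      apply: sqrt_le_sqr; first by rewrite mulr_ge0 ?sqrtr_ge0.
      by rewrite exprMn sqr_sqrtr//; lra.
    lra.
  apply: (le_trans hv); rewrite ge_max; apply/andP; split.
    by rewrite !mulr_ge0 ?sqrtr_ge0.
  exact: ler_wpM2l.
apply: (@le_trans _ _ ((2 * phat X z m + 3 * (L / nR)) * v)).
  by apply: ler_wpM2r => //; exact: ltW.
rewrite mulrDl; apply: lerD; last first.
  by rewrite ler_piMr// mulr_ge0.
apply: (@le_trans _ _ (2 * phat X z m * (Num.sqrt (2 * l) * (4 * Num.sqrt (L / N))))).
  by apply: ler_wpM2l => //; rewrite mulr_ge0// phat_ge0.
have ph0 : 0 < phat X z m by rewrite phatE divr_gt0.
have NE : N = nR * phat X z m by rewrite n_phat.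
(* the factor 12 comes from 8 * sqrt 2 <= 12 *)
have -> : 2 * phat X z m * (Num.sqrt (2 * l) * (4 * Num.sqrt (L / N))) =
    8 * (phat X z m * (Num.sqrt (2 * l) * Num.sqrt (L / N))) by ring.
have : phat X z m * (Num.sqrt (2 * l) * Num.sqrt (L / N)) <=
    3 / 2 * Num.sqrt (phat X z m * (L / (alpha * nR))).
  rewrite -sqrtrM ?mulr_ge0//.
  have {1}-> : phat X z m = Num.sqrt (phat X z m ^+ 2) by rewrite sqrtr_sqr gtr0_norm.
  rewrite -sqrtrM ?sqr_ge0//.
  apply: sqrt_le_sqr; first by rewrite mulr_ge0.
  rewrite [leRHS]exprMn sqr_sqrtr; last first.
    apply: mulr_ge0; first exact: ltW.
    by apply: divr_ge0 => //; apply: mulr_ge0; exact: ltW.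
  have -> : phat X z m ^+ 2 * (2 * l * (L / N)) = 2 * l * (phat X z m * (L / nR)).
    by rewrite NE; field; lra.
  have -> : (3 / 2) ^+ 2 * (phat X z m * (L / (alpha * nR))) =
     9 / 4 / alpha * (phat X z m * (L / nR)) by field; lra.
  apply: ler_wpM2r; first by rewrite mulr_ge0// ltW.
  rewrite ler_pdivlMr//; lra.
lra.
Qed.

Lemma sum_ptilde_le z : \sum_m p m = 1 ->
  \sum_m (ptilde X alpha z m - p m) <=
  2 * Num.sqrt (M%:R * (L / nR)) + 3 * (M%:R * (L / nR)).
Proof.
move=> p1; rewrite sumrB p1 /ptilde -/nR.
have L0 : 0 <= L / nR by rewrite divr_ge0 ?lg_ge0// ltW// n_gt0.
rewrite 2!big_split /= sum_phat sumr_const card_ord.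
rewrite (eq_bigr (fun m => Num.sqrt (phat X z m) * Num.sqrt (3 * L / nR))); last first.
  by move=> m _; rewrite sqrtrM// phat_ge0.
rewrite -mulr_suml.
have : Num.sqrt (3 * L / nR) <= 2 * Num.sqrt (L / nR).
  apply: sqrt_le_sqr; first by rewrite mulr_ge0 ?sqrtr_ge0.
  by rewrite exprMn sqr_sqrtr//; lra.
move=> /(ler_wpM2l (sqrtr_ge0 M%:R)) h2.
have := sum_sqrt_le (phat_ge0 z) (sum_phat z).
move=> /(ler_wpM2r (sqrtr_ge0 (3 * L / nR))) h1.
rewrite [Num.sqrt (M%:R * _)]sqrtrM//.
have -> : 3 * L / nR *+ M = 3 * (M%:R * (L / nR)) by rewrite -mulr_natl; ring.
lra.
Qed.

Lemma sum_pen_length_error z l : 0 <= l -> l * alpha <= 1 ->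
  (forall m, [/\ good_mass z m, good_upper z m true & good_upper z m false]) ->
  \sum_m p m * (pen_length l (pitilde X alpha z m) - pen_length l (pi m)) <=
  12 * Num.sqrt (M%:R * (L / (alpha * nR))) + 3 * (M%:R * (L / nR)).
Proof.
move=> l0 la hz; have [a0 a1] := andP alpha01.
have an0 : 0 < alpha * nR by rewrite mulr_gt0// n_gt0.
have L0 : 0 <= L / (alpha * nR) by rewrite divr_ge0 ?lg_ge0// ltW.
apply: (@le_trans _ _ (\sum_m (12 * (Num.sqrt (phat X z m) * Num.sqrt (L / (alpha * nR)))
    + 3 * (L / nR)))).
  apply: ler_sum => m _; rewrite -sqrtrM ?phat_ge0//.
  by have [? ? ?] := hz m; exact: pen_length_error.
rewrite big_split /= sumr_const card_ord -[X in X + _]mulr_sumr.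
have -> : 3 * (L / nR) *+ M = 3 * (M%:R * (L / nR)) by rewrite -mulr_natl; ring.
rewrite -mulr_suml [Num.sqrt (M%:R * _)]sqrtrM// lerD2r.
apply: ler_wpM2l => //; apply: ler_wpM2r; first exact: sqrtr_ge0.
exact: sum_sqrt_le (phat_ge0 z) (sum_phat z).
Qed.

End good_samples.

(** * Expectations over the covariate *)

Section bounded_expectation.
Context {d : measure_display} {T : measurableType d} {R : realType}.
Variable mu : probability T R.
Implicit Types g h : T -> R.

Definition bounded_mfun g := measurable_fun setT g /\ exists K, forall x, `|g x| <= K.

Lemma bounded_mfun01 g : measurable_fun setT g -> (forall x, 0 <= g x <= 1) -> bounded_mfun g.
Proof.
move=> mg g01; split=> //; exists 1 => x; have := g01 x.
by rewrite ler_norml; lra.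
Qed.

Lemma bounded_integrable g D : measurable D -> bounded_mfun g -> mu.-integrable D (EFin \o g).
Proof.
move=> mD [mg [K gK]]; apply: measurable_bounded_integrable => //.
- by rewrite (le_lt_trans (probability_le1 _ _))// ltry.
- exact: measurable_funTS.
- exists K; split; first exact: num_real.
  by move=> y Ky x _; apply: le_trans (gK x) _; exact: ltW.
Qed.

Lemma bounded_mfunD g h : bounded_mfun g -> bounded_mfun h ->
  bounded_mfun (fun x => g x + h x).
Proof.
move=> [mg [K gK]] [mh [K' hK]]; split; first exact: measurable_funD.
by exists (K + K') => x; apply: le_trans (ler_normD _ _) _; exact: lerD.
Qed.

Lemma bounded_mfunM g h : bounded_mfun g -> bounded_mfun h ->
  bounded_mfun (fun x => g x * h x).
Proof.
move=> [mg [K gK]] [mh [K' hK]]; split; first exact: measurable_funM.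
by exists (K * K') => x; rewrite normrM; apply: ler_pM.
Qed.

Lemma bounded_mfun_cst k : bounded_mfun (fun=> k).
Proof. by split; [exact: measurable_cst|exists `|k|]. Qed.

Lemma bounded_mfun_norm g : bounded_mfun g -> bounded_mfun (fun x => `|g x|).
Proof.
move=> [mg [K gK]]; split; first exact: measurableT_comp.
by exists K => x; rewrite normr_id.
Qed.

Lemma bounded_mfun_sqrt g : bounded_mfun g -> bounded_mfun (fun x => Num.sqrt (g x)).
Proof.
move=> [mg [K gK]]; split; first exact: (measurableT_comp measurable_sqrt).
exists (Num.sqrt K) => x; rewrite ger0_norm ?sqrtr_ge0//; apply: ler_wsqrtr.
exact: le_trans (ler_norm _) (gK x).
Qed.

Lemma Rintegral_fin_sum (I : finType) (h : I -> T -> R) :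
  (forall i, bounded_mfun (h i)) ->
  \int[mu]_x (\sum_i h i x) = \sum_i \int[mu]_x h i x.
Proof.
move=> hh; rewrite /Rintegral.
under eq_integral do rewrite -sumEFin.
rewrite integral_sum//; last by move=> i; exact: bounded_integrable.
rewrite -sum_fine// => i _.
by apply: integrable_fin_num => //; exact: bounded_integrable.
Qed.

Lemma le_expectation g h : bounded_mfun g -> bounded_mfun h ->
  (forall x, g x <= h x) -> \int[mu]_x g x <= \int[mu]_x h x.
Proof. by move=> bg bh gh; apply: le_Rintegral => //; exact: bounded_integrable. Qed.

Lemma EFin_expectation g D : measurable D -> bounded_mfun g ->
  (\int[mu]_(x in D) (g x)%:E = (\int[mu]_(x in D) g x)%:E)%E.
Proof.
move=> mD bg; rewrite /Rintegral fineK//.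
by apply: integrable_fin_num => //; exact: bounded_integrable.
Qed.

(** Jensen's inequality for the square root, from its tangent lines. *)
Lemma expectation_sqrt g : bounded_mfun g -> (forall x, 0 <= g x) ->
  \int[mu]_x Num.sqrt (g x) <= Num.sqrt (\int[mu]_x g x).
Proof.
move=> bg g0; set D := \int[mu]_x g x.
have D0 : 0 <= D by apply: Rintegral_ge0 => x _.
have bsq := bounded_mfun_sqrt bg.
have tangent e : 0 < e -> \int[mu]_x Num.sqrt (g x) <= e / 2 + D / (2 * e).
  move=> e0.
  have -> : e / 2 + D / (2 * e) = \int[mu]_x (e / 2 + g x * (2 * e)^-1).
    rewrite RintegralD//; [|exact: finite_measure_integrable_cst|]; last first.
      by apply: bounded_integrable => //; apply: bounded_mfunM => //; exact: bounded_mfun_cst.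
    rewrite Rintegral_cst//  RintegralZr//; last exact: bounded_integrable.
    by rewrite [X in fine X](@probability_setT _ _ _ mu) /= mulr1.
  apply: le_expectation => // [|x].
    by apply: bounded_mfunD; [|apply: bounded_mfunM => //]; exact: bounded_mfun_cst.
  have := sqr_sqrtr (g0 x); move: (Num.sqrt (g x)) => v <-.
  have : 0 <= (v - e) ^+ 2 / (2 * e) by rewrite divr_ge0 ?sqr_ge0//; lra.
  have -> : (v - e) ^+ 2 / (2 * e) = e / 2 + v ^+ 2 * (2 * e)^-1 - v by field; lra.
  lra.
have := D0; rewrite le_eqVlt => /predU1P[D00|Dp].
  rewrite -D00 sqrtr0 in tangent *; rewrite leNgt; apply/negP => h.
  by have := tangent _ h; rewrite mul0r; lra.
have s0 : 0 < Num.sqrt D by rewrite sqrtr_gt0.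
have := tangent _ s0; rewrite -{2}(sqr_sqrtr D0).
have -> : Num.sqrt D / 2 + Num.sqrt D ^+ 2 / (2 * Num.sqrt D) = Num.sqrt D by field; lra.
by [].
Qed.

End bounded_expectation.

Section cells.
Context {R : realType} {d M : nat}.
Variables (X : mpartition R d M) (P : probability (datapt R d) R)
  (piP : {mfun Rvec R d >-> R}).
Hypothesis reg : is_regression P piP.
Local Notation PX := (marginalX P).

Lemma measurable_cell_fun dY (Y : measurableType dY) (f : 'I_M -> Y -> R) (x : Y -> Rvec R d) :
  measurable_fun setT x -> (forall m, measurable_fun setT (f m)) ->
  measurable_fun setT (fun y => f (cell_index X (x y)) y).
Proof.
move=> mx mf.
rewrite (_ : (fun y => _) = (fun y => \sum_m f m y * \1_(cell X m) (x y))); last first.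
  by apply/funext => y; rewrite (cell_indicator X (fun m => f m y)).
apply: measurable_sum => m; apply: measurable_funM => //.
apply: (measurableT_comp _ mx); apply: measurable_indic; exact: cell_measurable.
Qed.

Lemma bounded_cell_fun (c : 'I_M -> R) : bounded_mfun (fun x => c (cell_index X x)).
Proof.
split; first exact: (@measurable_cell_fun _ _ (fun m _ => c m) id).
exists (\sum_m `|c m|) => x; rewrite (bigD1 (cell_index X x))//= lerDl.
by apply: sumr_ge0.
Qed.

Lemma expectation_cells (c : 'I_M -> R) (g : Rvec R d -> R) : bounded_mfun g ->
  \int[PX]_x (c (cell_index X x) * g x) = \sum_m c m * \int[PX]_(x in cell X m) g x.
Proof.
move=> bg.
have bi m : bounded_mfun (\1_(cell X m) : Rvec R d -> R).
  apply: bounded_mfun01; first by apply: measurable_indic; exact: cell_measurable.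
  by move=> x; rewrite indicE; case: (_ \in _); rewrite ?lexx ?ler01.
transitivity (\int[PX]_x (\sum_m c m * (\1_(cell X m) x * g x))).
  apply: eq_Rintegral => x _; rewrite (cell_indicator X c) mulr_suml.
  by apply: eq_bigr => m _; rewrite mulrA.
rewrite Rintegral_fin_sum; last first.
  by move=> m; apply: bounded_mfunM; [exact: bounded_mfun_cst|exact: bounded_mfunM].
apply: eq_bigr => m _; rewrite RintegralZl//; last first.
  by apply: bounded_integrable => //; exact: bounded_mfunM.
congr (_ * _); rewrite [RHS]Rintegral_mkcond; apply: eq_Rintegral => x _.
rewrite patchE indicE; case: ifPn => xm; first by rewrite mul1r.
by rewrite mul0r.
Qed.

Local Notation p := (cell_prob X P).
Local Notation pi := (cell_mean X P piP).

Lemma cell_prob_bounds m : 0 <= p m <= 1.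
Proof. by apply: prob_fine01; exact: cell_measurable. Qed.

Lemma expectation_cell_cst (c : 'I_M -> R) :
  \int[PX]_x c (cell_index X x) = \sum_m c m * p m.
Proof.
transitivity (\int[PX]_x (c (cell_index X x) * 1)).
  by apply: eq_Rintegral => x _; rewrite mulr1.
rewrite expectation_cells; last exact: bounded_mfun_cst.
apply: eq_bigr => m _; rewrite Rintegral_cst ?mul1r//; exact: cell_measurable.
Qed.

Lemma sum_cell_prob : \sum_m p m = 1.
Proof.
have := expectation_cell_cst (fun=> 1); rewrite Rintegral_cst// mul1r.
rewrite [X in fine X](@probability_setT _ _ _ PX) /= => e; rewrite [RHS]e.
by apply: eq_bigr => m _; rewrite mul1r.
Qed.

Lemma bounded_piP : bounded_mfun piP.
Proof. by apply: bounded_mfun01 => //; case: reg. Qed.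

Lemma cell_integral m : \int[PX]_(x in cell X m) piP x = p m * pi m.
Proof.
have mc := cell_measurable X m.
(* on a null cell both sides vanish, whatever value the mean takes there *)
have [p0|p0] := eqVneq (p m) 0; last by rewrite /cell_mean; field.
have [pi01 _] := reg.
rewrite p0 mul0r; apply/eqP; rewrite eq_le; apply/andP; split; last first.
  by apply: Rintegral_ge0 => x _; case/andP: (pi01 x).
have -> : 0 = \int[PX]_(x in cell X m) (1 : R) by rewrite Rintegral_cst// mul1r.
apply: le_Rintegral => //; [exact/bounded_integrable/bounded_piP|..].
  exact: finite_measure_integrable_cst.
by move=> x _; case/andP: (pi01 x).
Qed.

Lemma cell_mean_bounds m : 0 <= pi m <= 1.
Proof.
have mc := cell_measurable X m; have [pi01 _] := reg.
have p01 := cell_prob_bounds m.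
have [p0|p0] := eqVneq (p m) 0.
  by rewrite /cell_mean p0 invr0 mulr0 lexx ler01.
have pp : 0 < p m by rewrite lt_neqAle eq_sym p0; case/andP: p01.
have h0 : 0 <= \int[PX]_(x in cell X m) piP x.
  by apply: Rintegral_ge0 => x _; case/andP: (pi01 x).
have h1 : \int[PX]_(x in cell X m) piP x <= p m.
  have -> : p m = \int[PX]_(x in cell X m) (1 : R) by rewrite Rintegral_cst// mul1r.
  apply: le_Rintegral => //; [exact/bounded_integrable/bounded_piP|..].
    exact: finite_measure_integrable_cst.
  by move=> x _; case/andP: (pi01 x).
apply/andP; split; first by rewrite /cell_mean divr_ge0// ltW.
by rewrite /cell_mean ler_pdivrMr// mul1r.
Qed.

Lemma prob_cell_pts m : P (cell_pts X m) = (p m)%:E.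
Proof.
have mc := cell_measurable X m.
rewrite /cell_prob fineK ?fin_num_measure//.
rewrite /marginalX /distribution /pushforward; congr (P _).
by apply/seteqP; split=> [[x y] []|[x y]].
Qed.

Lemma measurable_cell_pts m : measurable (cell_pts X m).
Proof. by apply: measurableX => //; exact: cell_measurable. Qed.

Lemma measurable_label_pts m y : measurable (label_pts X m y).
Proof. by apply: measurableX => //; exact: cell_measurable. Qed.

Lemma prob_label_pts m y :
  P (label_pts X m y) = (fine (P (cell_pts X m)) * label_mean pi m y)%:E.
Proof.
have mc := cell_measurable X m; have [_ regP] := reg.
have htrue : P (label_pts X m true) = (p m * pi m)%:E.
  rewrite [LHS](regP _ mc) EFin_expectation//; last exact: bounded_piP.
  by rewrite cell_integral.
rewrite prob_cell_pts /=; case: y => //=.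
have -> : label_pts X m false = cell_pts X m `\` label_pts X m true.
  apply/seteqP; split=> -[x y] /=; first by move=> [xm yf]; split=> // -[_]; rewrite yf.
  by move=> [[xm _] h]; split=> //; apply/negbTE/negP => yt; apply: h.
have ml := measurable_label_pts m true.
rewrite measureD//; [|exact: measurable_cell_pts|]; last first.
  by rewrite -ge0_fin_numE ?measure_ge0// fin_num_measure//; exact: measurable_cell_pts.
rewrite setIidr; last by move=> [x y] [].
rewrite [X in (_ - X)%E]htrue [X in (X - _)%E]prob_cell_pts -EFinB; congr EFin; ring.
Qed.

(** The Hoelder bound for a multiplier of at most [1 / alpha], averaged by
    Jensen's inequality, produces exactly the blur term. *)
Lemma expectation_pen_length_cells l alpha : 0 < alpha -> 0 <= l -> l * alpha <= 1 ->
  \sum_m p m * pen_length l (pi m) <=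
  \int[PX]_x pen_length l (piP x) + Num.sqrt (2 * blur X P piP / alpha).
Proof.
move=> a0 l0 la; have [pi01 _] := reg.
have mpi : measurable_fun setT piP by exact: measurable_funP.
have bv : bounded_mfun (fun x => pen_length l (piP x)).
  by apply: bounded_mfun01 => [|x]; [exact: measurable_pen_length|exact: pen_length_bounds].
have bgap : bounded_mfun (fun x => `|piP x - pi (cell_index X x)|).
  apply: bounded_mfun_norm; apply: bounded_mfunD; first exact: bounded_piP.
  exact: (bounded_cell_fun (fun m => - pi m)).
pose g x := 2 / alpha * `|piP x - pi (cell_index X x)|.
have bg : bounded_mfun g by apply: bounded_mfunM => //; exact: bounded_mfun_cst.
have g0 x : 0 <= g x by rewrite mulr_ge0// divr_ge0// ltW.
have bsg := bounded_mfun_sqrt bg.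
have -> : 2 * blur X P piP / alpha = \int[PX]_x g x.
  rewrite /g RintegralZl//; last exact: bounded_integrable.
  by rewrite /blur; ring.
apply: (@le_trans _ _ (\int[PX]_x pen_length l (piP x) + \int[PX]_x Num.sqrt (g x))); last first.
  by rewrite lerD2l; exact: expectation_sqrt.
rewrite -RintegralD//; [|exact: bounded_integrable..].
under eq_bigr do rewrite mulrC.
rewrite -(expectation_cell_cst (fun m => pen_length l (pi m))).
apply: le_expectation;
  [exact: (bounded_cell_fun (fun m => pen_length l (pi m)))|exact: bounded_mfunD|].
move=> x; apply: le_trans (pen_length_holder l0 (cell_mean_bounds _) (pi01 x)) _.
rewrite lerD2l distrC; apply: ler_wsqrtr; rewrite /g.
by apply: ler_wpM2r => //; rewrite ler_pdivlMr//; lra.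
Qed.

(** Weak duality: integrating [pen_length_le] against a rule [a] that spends at most
    [alpha]. *)
Lemma optimal_length_dual l alpha : 0 <= l ->
  ((\int[PX]_x pen_length l (piP x) - l * alpha)%:E <=
   optimal_length alpha (distribution PX piP))%E.
Proof.
move=> l0; have [pi01 _] := reg.
have mpi : measurable_fun setT piP by exact: measurable_funP.
have bv : bounded_mfun (fun x => pen_length l (piP x)).
  by apply: bounded_mfun01 => [|x]; [exact: measurable_pen_length|exact: pen_length_bounds].
apply: le_ereal_inf_tmp => _ [a [ma a01 aalpha] <-].
pose I : set R := `[0%R, 1%R]%classic.
have mI : measurable I by exact: measurable_itv.
have inI t : (0 <= t <= 1) = (t \in I) by rewrite mem_setE in_itv.
(* a rule is only assumed measurable on the unit interval *)
pose a' t := if t \in I then a t else 0.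
have ma' : measurable_fun setT a'.
  rewrite /a' (_ : (fun t => _) = a \_ I); last by apply/funext => t; rewrite patchE.
  by apply/(measurable_restrictT a).
have a'01 t : 0 <= a' t <= 1.
  rewrite /a'; case: ifPn => ht; last by rewrite lexx ler01.
  by apply: a01; rewrite inI.
have piI x : piP x \in I by rewrite -inI.
have pre : piP @^-1` I = setT.
  by apply/seteqP; split=> // x _; have /set_mem := piI x.
have mel : measurable_fun setT (fun t => ell t (a' t)) by exact: measurable_ell.
have push (h h' : R -> R) : measurable_fun setT h ->
    (forall t, 0 <= t <= 1 -> 0 <= h t) -> (forall t, t \in I -> h t = h' t) ->
    (\int[distribution PX piP]_(t in I) (h' t)%:E = \int[PX]_x (h (piP x))%:E)%E.
  move=> mh h0 hh'.
  transitivity (\int[distribution PX piP]_(t in I) (h t)%:E)%E.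
    by apply: eq_integral => t tI; rewrite hh'.
  rewrite ge0_integral_pushforward//.
  - by rewrite pre.
  - by apply/measurable_EFinP; exact: measurable_funTS.
  - by move=> t tI; rewrite lee_fin h0// inI.
have aE t : t \in I -> a' t = a t by rewrite /a' => ->.
have b1 : bounded_mfun (fun x => a' (piP x)).
  by apply: bounded_mfun01 => // ; exact: measurableT_comp.
have b2 : bounded_mfun (fun x => ell (piP x) (a' (piP x))).
  apply: bounded_mfun01 => [|x]; first exact: (measurableT_comp mel).
  by apply: ell_bounds.
rewrite (push (fun t => ell t (a' t)) (fun t => ell t (a t)))//; last 2 first.
  by move=> t t01; case/andP: (ell_bounds t01 (a'01 t)).
  by move=> t tI; rewrite aE.
move: aalpha; rewrite (push a' a)//; last by move=> t _; case/andP: (a'01 t).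
rewrite !EFin_expectation// !lee_fin => aalpha.
rewrite lerBlDr.
apply: (@le_trans _ _ (\int[PX]_x (ell (piP x) (a' (piP x)) + l * a' (piP x)))).
  apply: le_expectation => //.
    by apply: bounded_mfunD => //; apply: bounded_mfunM => //; exact: bounded_mfun_cst.
  by move=> x; apply: pen_length_le.
rewrite RintegralD//; [|exact: bounded_integrable|]; last first.
  by apply: bounded_integrable => //; apply: bounded_mfunM => //; exact: bounded_mfun_cst.
rewrite RintegralZl//; last exact: bounded_integrable.
by rewrite lerD2l; apply: ler_wpM2l.
Qed.

Lemma optimal_length_ge0 alpha : (0 <= optimal_length alpha (distribution PX piP))%E.
Proof.
apply: le_ereal_inf_tmp => _ [a [ma a01 _] <-]; apply: integral_ge0 => t /=.
rewrite in_itv /= => t01; rewrite lee_fin.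
by case/andP: (ell_bounds t01 (a01 _ t01)).
Qed.

End cells.

(** * Probability of a sample that is not good *)

Section bad_samples.
Context {R : realType} {d M n : nat}.
Variables (X : mpartition R d M) (alpha : R).
Hypotheses (n2 : (2 <= n)%N) (M1 : (1 <= M)%N) (alpha01 : 0 < alpha <= 1).
Variables (P : probability (datapt R d) R) (piP : {mfun Rvec R d >-> R}).
Hypothesis reg : is_regression P piP.
Variable nu : probability (n.-tuple (datapt R d)) R.
Hypothesis nu_box : forall A : 'I_n -> set (datapt R d), (forall i, measurable (A i)) ->
  nu (box A) = (\prod_(i < n) P (A i))%E.

Local Notation L := (lg (M := M) (n := n) alpha).
Local Notation p := (cell_prob X P).
Local Notation pi := (cell_mean X P piP).

(** The five ways in which the counts of a cell can deviate. Coverage and length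
    exclude different ones, hence the index type. *)
Definition failure (k : option (bool * bool)) m : set (n.-tuple (datapt R d)) :=
  match k with
  | None => [set z | ~~ (good_mass X alpha p z m)]
  | Some (true, y) => [set z | ~~ (good_lower X alpha pi z m y)]
  | Some (false, y) => [set z | ~~ (good_upper X alpha pi z m y)]
  end.

Lemma failureE k m : failure k m = match k with
  | None => [set z | hits (cell_pts X m) z <
      hits setT z * p m - Num.sqrt (2 * (hits setT z * p m) * L)]
  | Some (true, y) => [set z | hits (label_pts X m y) z <
      hits (cell_pts X m) z * label_mean pi m y
      - Num.sqrt (2 * (hits (cell_pts X m) z * label_mean pi m y) * L)]
  | Some (false, y) => [set z | hits (cell_pts X m) z * label_mean pi m y
      + 3 * Num.sqrt (hits (cell_pts X m) z * label_mean pi m y * L) + 3 * L <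
      hits (label_pts X m y) z]
  end.
Proof.
case: k => [[[] y]|] /=; apply/funext => z.
- by rewrite /mkset /good_lower -ltNge.
- by rewrite /mkset /good_upper -ltNge.
- have hT : hits (R := R) [set: datapt R d] z = n%:R.
    rewrite /hits (eq_bigr (fun=> 1)) ?sumr_const ?card_ord// => i _.
    by rewrite indicE in_setT.
  by rewrite /mkset /good_mass hT -ltNge.
Qed.

Lemma measurable_failure k m : measurable (failure k m).
Proof.
have mc := measurable_cell_pts X m; have ml y := measurable_label_pts X m y.
rewrite failureE; case: k => [[[] y]|].
- exact: measurable_lower_event.
- exact: measurable_upper_event.
- exact: measurable_lower_event.
Qed.

Lemma failure_prob k m : (nu (failure k m) <= (expR (- L))%:E)%E.
Proof.
have L1 := lg_ge1 n2 M1 alpha01; have L0 : 0 <= L by lra.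
have Lp : 0 < L by lra.
have mc := measurable_cell_pts X m.
have cp := cell_prob_bounds X P m; have cm := cell_mean_bounds X reg m.
have ml y := measurable_label_pts X m y.
have sub y : label_pts X m y `<=` cell_pts X m by move=> [x y'] [].
have lm01 y : 0 <= label_mean pi m y <= 1 by rewrite /label_mean; case: y => /=; lra.
rewrite failureE; case: k => [[[] y]|].
- by apply: (@lower_tail _ _ _ _ P) => //; exact: prob_label_pts.
- by apply: (@upper_tail _ _ _ _ P) => //; exact: prob_label_pts.
- apply: (@lower_tail _ _ _ _ P) => //.
  by rewrite probability_setT mul1r prob_cell_pts.
Qed.

Definition failures (Q : pred (option (bool * bool))) : set (n.-tuple (datapt R d)) :=
  \bigcup_(j in [set j : 'I_M * option (bool * bool) | Q j.2]) failure j.2 j.1.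

Lemma measurable_failures Q : measurable (failures Q).
Proof. by apply: fin_bigcup_measurable => // j _; exact: measurable_failure. Qed.

Lemma failures_prob Q : (nu (failures Q) <= (#|Q|%:R * alpha / (4 * n%:R))%:E)%E.
Proof.
have [a0 a1] := andP alpha01.
have mF (j : 'I_M * option (bool * bool)) : measurable (failure j.2 j.1).
  exact: measurable_failure.
apply: (le_trans (measure_union_le nu (fun j : 'I_M * option (bool * bool) => Q j.2) mF)).
apply: (@le_trans _ _ (\sum_(j : 'I_M * option (bool * bool) | Q j.2) (expR (- L))%:E)%E).
  by apply: lee_sum => j _; exact: failure_prob.
rewrite sumEFin lee_fin.
have n0 : 0 < n%:R :> R by rewrite ltr0n (leq_trans _ n2).
have M0 : 0 < M%:R :> R by rewrite ltr0n.
have q0 : 0 < (4 * M * n)%:R / alpha :> R.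
  by rewrite divr_gt0// ltr0n !muln_gt0 M1 (leq_trans _ n2).
have -> : expR (- L) = alpha / (4 * M%:R * n%:R).
  rewrite expRN /lg lnK ?posrE// !natrM; field; lra.
rewrite -(pair_big xpredT Q (fun=> fun=> alpha / (4 * M%:R * n%:R))) /=.
rewrite !sumr_const card_ord.
rewrite -[_ *+ #|_|]mulr_natr -[_ *+ M]mulr_natr.
rewrite le_eqVlt; apply/orP; left; apply/eqP; field; lra.
Qed.

Definition coverage_failures : set (n.-tuple (datapt R d)) :=
  failures (fun k => if k is Some (false, _) then false else true).

Definition length_failures : set (n.-tuple (datapt R d)) := failures predT.

Lemma coverage_failures_prob :
  (nu coverage_failures <= (3 * alpha / (4 * n%:R))%:E)%E.
Proof.
apply: (le_trans (failures_prob _)); rewrite lee_fin.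
have n0 : 0 < n%:R :> R by rewrite ltr0n (leq_trans _ n2).
have [a0 _] := andP alpha01.
apply: ler_wpM2r; first by rewrite invr_ge0 mulr_ge0// ltW.
apply: ler_wpM2r; first exact: ltW.
rewrite ler_nat; apply: leq_trans (card_size [:: None; Some (true, true); Some (true, false)]).
apply: subset_leq_card; apply/fintype.subsetP => -[[[] []]|] //.
Qed.

Lemma length_failures_prob :
  (nu length_failures <= (5 * alpha / (4 * n%:R))%:E)%E.
Proof.
apply: (le_trans (failures_prob _)).
by rewrite (eq_card (B := predT))// card_option card_prod card_bool.
Qed.

Lemma coverage_goodP z : ~ coverage_failures z -> forall m,
  [/\ good_mass X alpha p z m, good_lower X alpha pi z m true &
      good_lower X alpha pi z m false].
Proof.
move=> zF m; split; apply/negPn/negP => h; apply: zF.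
- by exists (m, None).
- by exists (m, Some (true, true)).
- by exists (m, Some (true, false)).
Qed.

Lemma length_goodP z : ~ length_failures z -> forall m,
  [/\ good_mass X alpha p z m, good_upper X alpha pi z m true &
      good_upper X alpha pi z m false].
Proof.
move=> zF m; split; apply/negPn/negP => h; apply: zF.
- by exists (m, None).
- by exists (m, Some (false, true)).
- by exists (m, Some (false, false)).
Qed.

End bad_samples.

(** * Randomization by the uniform variable *)

Section measurable_construction.
Context {R : realType} {d M n : nat}.
Variables (X : mpartition R d M) (alpha : R).
Hypothesis n2 : (2 <= n)%N.

Lemma measurable_phat m :
  measurable_fun [set: n.-tuple (datapt R d)] (fun z => phat X z m).
Proof.
rewrite (_ : (fun z => _) = fun z => hits (cell_pts X m) z * n%:R^-1); last first.
  by apply/funext => z; rewrite phatE.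
by apply: measurable_funM => //; apply: measurable_hits; exact: measurable_cell_pts.
Qed.

Lemma measurable_pihat m :
  measurable_fun [set: n.-tuple (datapt R d)] (fun z => pihat X z m).
Proof.
have mp := measurable_phat m.
apply: measurable_fun_ifT => //; first exact: measurable_fun_eqr.
apply: measurable_funM; first exact: (measurable_hits (measurable_label_pts X m true)).
by apply: (measurableT_comp measurable_inv); exact: measurable_funM.
Qed.

Lemma measurable_pitilde m :
  measurable_fun [set: n.-tuple (datapt R d)] (fun z => pitilde X alpha z m).
Proof.
have mp := measurable_phat m; have mh := measurable_pihat m.
have mr : measurable_fun [set: n.-tuple (datapt R d)]
    (fun z => 2 * lg (M := M) (n := n) alpha / (n%:R * phat X z m)).
  apply: measurable_funM => //; apply: (measurableT_comp measurable_inv).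
  exact: measurable_funM.
rewrite /pitilde; apply: measurable_fun_ifT; first exact: measurable_fun_ler.
- apply: measurable_minr => //; apply: measurable_funD => //; apply: measurable_funD => //.
  by apply: (measurableT_comp measurable_sqrt); exact: measurable_funM.
- apply: measurable_maxr => //; apply: measurable_funB => //; apply: measurable_funB => //.
  apply: (measurableT_comp measurable_sqrt); apply: measurable_funM => //.
  exact: measurable_funB.
Qed.

Variable atilde : n.-tuple (datapt R d) -> 'I_M -> R.
Hypothesis matilde : forall m, measurable_fun [set: n.-tuple (datapt R d)] (atilde ^~ m).

Lemma measurable_Chat dY (Y : measurableType dY) (z : Y -> n.-tuple (datapt R d))
    (x : Y -> Rvec R d) (u s : Y -> R) :
  measurable_fun setT z -> measurable_fun setT x ->
  measurable_fun setT u -> measurable_fun setT s ->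
  measurable [set y | Chat X alpha atilde (z y) (u y) (x y) (s y)].
Proof.
move=> mz mx mu ms.
have mt : measurable_fun setT (fun y => pitilde X alpha (z y) (cell_index X (x y))).
  apply: (@measurable_cell_fun _ _ _ X _ Y (fun m y => pitilde X alpha (z y) m)) => // m.
  exact: (measurableT_comp (measurable_pitilde m)).
have ma : measurable_fun setT (fun y => atilde (z y) (cell_index X (x y))).
  apply: (@measurable_cell_fun _ _ _ X _ Y (fun m y => atilde (z y) m)) => // m.
  exact: (measurableT_comp (matilde m)).
exact: measurable_level_set.
Qed.

End measurable_construction.

Section randomization.
Context {R : realType} {d M : nat}.
Variables (X : mpartition R d M) (t a : 'I_M -> R).
Hypotheses (t01 : forall m, 0 < t m < 1) (a01 : forall m, 0 <= a m <= 1).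
Let mu := @lebesgue_measure R.

Lemma unif01_le (y : R) : 0 <= y <= 1 -> unif01 R [set u | u <= y] = y%:E.
Proof.
move=> y01; rewrite /unif01 /= /uniform_prob integral_uniform_pdf.
have -> : [set u | u <= y] `&` `[0%R, 1%R] = `[0%R, y]%classic :> set R.
  apply/seteqP; split=> u /=; rewrite !in_itv /=; first by move=> [h /andP[-> _]].
  by move=> /andP[h0 h1]; split=> //; rewrite h0; lra.
rewrite (eq_integral (fun=> 1%:E)); last first.
  move=> u; rewrite inE /= in_itv /= => /andP[u0 uy]; rewrite /uniform_pdf subr0 invr1.
  by rewrite u0 (le_trans uy)//; case/andP: y01.
rewrite integral_cst//= mul1e lebesgue_measure_itv/= lte_fin.
have [y0|y0] := ltP 0 y; first by rewrite oppr0 adde0.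
by congr EFin; lra.
Qed.

Lemma measurable_C_ta dY (Y : measurableType dY) (x : Rvec R d) (u s : Y -> R) :
  measurable_fun setT u -> measurable_fun setT s ->
  measurable [set y | C_ta X t a (u y) x (s y)].
Proof.
by move=> mu' ms; apply: measurable_level_set => //; exact: measurable_cst.
Qed.

(** By Fubini's theorem: for a fixed [s], the uniform variable is below the
    level function with probability [f_ta t a s]. *)
Lemma expected_length x :
  (\int[unif01 R]_u mu (C_ta X t a u x) =
   (ell (t (cell_index X x)) (a (cell_index X x)))%:E)%E.
Proof.
pose D : set (measurableTypeR R * R) := [set y | C_ta X t a y.1 x y.2].
have mD : measurable D by exact: measurable_C_ta.
rewrite -integral_f_ta//.
transitivity ((unif01 R \x mu) D)%E.
  apply: eq_integral => u _ /=; congr (mu _).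
  by apply/seteqP; split=> s; rewrite /xsection /= inE.
transitivity ((unif01 R \x^ mu) D)%E.
  by apply: product_measure_unique => // A B mA mB; rewrite [LHS]product_measure2E.
rewrite [RHS]integral_mkcond; apply: eq_integral => s _ /=; rewrite patchE.
have ysE : ysection D s = [set u | D (u, s)].
  by apply/seteqP; split=> u; rewrite /ysection /= inE.
case: ifPn; rewrite ?inE ?notin_setE /= in_itv /= => s01.
  rewrite -[RHS]unif01_le; last exact: f_ta_ge0_le1.
  rewrite ysE; congr (unif01 R _); apply/seteqP; split=> u /=.
    by move=> [].
  by move=> ?; split.
have -> : ysection D s = set0 by rewrite ysE; apply/seteqP; split=> u // [].
exact: measure0.
Qed.

Lemma coverage_prob x s : 0 <= s <= 1 ->
  unif01 R [set u | C_ta X t a u x s] =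
  (f_ta (t (cell_index X x)) (a (cell_index X x)) s)%:E.
Proof.
move=> s01; rewrite -unif01_le; last exact: f_ta_ge0_le1.
congr (unif01 R _); apply/seteqP; split=> u /=; first by move=> [].
by move=> ?; split.
Qed.

End randomization.

(** * Guarantees on good samples *)

Section guarantees.
Context {R : realType} {d M n : nat}.
Variables (X : mpartition R d M) (alpha : R).
Hypotheses (n2 : (2 <= n)%N) (M1 : (1 <= M)%N) (alpha01 : 0 < alpha <= 1).
Variable atilde : n.-tuple (datapt R d) -> 'I_M -> R.
Hypothesis argmin : argmin_rule X alpha atilde.
Variables (P : probability (datapt R d) R) (piP : {mfun Rvec R d >-> R}).
Hypothesis reg : is_regression P piP.

Local Notation L := (lg (M := M) (n := n) alpha).
Local Notation p := (cell_prob X P).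
Local Notation pi := (cell_mean X P piP).
Local Notation PX := (marginalX P).
Local Notation y := (M%:R * (L / (alpha * n%:R))).
Implicit Types z : n.-tuple (datapt R d).

Lemma atilde_bounds z m : 0 <= atilde z m <= 1.
Proof. by have [h _] := argmin; have [[/(_ m)]] := h z. Qed.

Lemma pitilde01 z m : 0 <= pitilde X alpha z m <= 1.
Proof. by have := pitilde_bounds X n2 M1 alpha01 z m; lra. Qed.

Lemma ptilde_ge0 z m : 0 <= ptilde X alpha z m.
Proof.
have L0 := lg_ge0 n2 M1 alpha01; have ph := phat_ge0 X z m.
rewrite /ptilde; apply: addr_ge0; last by apply: divr_ge0 => //; exact: mulr_ge0.
by apply: addr_ge0 => //; exact: sqrtr_ge0.
Qed.

Lemma good_mass_le_ptilde z m : good_mass X alpha p z m -> p m <= ptilde X alpha z m.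
Proof.
move=> /(good_mass_ptilde n2 M1 alpha01 (cell_prob_bounds X P)).
by apply: le_trans; rewrite lerDl; apply: divr_ge0 => //; exact: (lg_ge0 n2 M1 alpha01).
Qed.

(** Strong duality for the estimated problem and weak duality for the true one
    are used with the same multiplier [l], which depends on the sample; this is
    why the estimates of [pen_length] have to hold for all [l] at once. *)
Lemma good_length z :
  (forall m, [/\ good_mass X alpha p z m, good_upper X alpha pi z m true &
      good_upper X alpha pi z m false]) ->
  ((\sum_m ell (pitilde X alpha z m) (atilde z m) * p m)%:E <=
   optimal_length alpha (distribution PX piP) +
   (Num.sqrt (2 * blur X P piP / alpha) + (14 * Num.sqrt y + 6 * y))%:E)%E.
Proof.
move=> good; have [a0 a1] := andP alpha01.
have n0 := @n_gt0 R n n2; have L0 := lg_ge0 n2 M1 alpha01.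
have pt := pitilde01 z; have at01 := atilde_bounds z.
have pm01 := cell_prob_bounds X P; have pim01 := cell_mean_bounds X reg.
have ppt m : p m <= ptilde X alpha z m by apply: good_mass_le_ptilde; case: (good m).
have y0 : 0 <= y by rewrite mulr_ge0// divr_ge0// mulr_ge0// ltW.
have Ly : M%:R * (L / n%:R) <= y.
  apply: ler_wpM2l => //; apply: ler_wpM2l => //.
  by rewrite lef_pV2 ?posrE ?mulr_gt0// ler_piMl// ltW.
have sLy : Num.sqrt (M%:R * (L / n%:R)) <= Num.sqrt y by exact: ler_wsqrtr.
have p1 := sum_cell_prob X P.
have hS := sum_ptilde_le X n2 M1 alpha01 z p1.
have sy := sqrtr_ge0 y.
have sb := sqrtr_ge0 (2 * blur X P piP / alpha).
set S := \sum_m (ptilde X alpha z m - p m) in hS.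
have [l l0 lag] : exists2 l, 0 <= l &
    \sum_m ptilde X alpha z m * ell (pitilde X alpha z m) (atilde z m) <=
    \sum_m ptilde X alpha z m * pen_length l (pitilde X alpha z m) - l * alpha.
  apply: lagrange_multiplier => // [m|b b01 bsum]; first exact: ptilde_ge0.
  have [h _] := argmin; have [_ hmin] := h z.
  by apply: hmin; split.
have le1 : \sum_m ell (pitilde X alpha z m) (atilde z m) * p m <=
    \sum_m p m * pen_length l (pitilde X alpha z m) + S - l * alpha.
  apply: (@le_trans _ _
    (\sum_m ptilde X alpha z m * ell (pitilde X alpha z m) (atilde z m))).
    apply: ler_sum => m _; rewrite mulrC; apply: ler_wpM2r => //.
    by case/andP: (ell_bounds (pt m) (at01 m)).
  apply: (le_trans lag); rewrite lerD2r /S -big_split /=.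
  apply: ler_sum => m _.
  have /andP[_ v1] := pen_length_bounds (pitilde X alpha z m) l0.
  have : 0 <= (ptilde X alpha z m - p m) * (1 - pen_length l (pitilde X alpha z m)).
    by rewrite mulr_ge0// subr_ge0.
  lra.
have L_ge0 := optimal_length_ge0 P piP alpha.
have [la|la] := leP (l * alpha) 1; last first.
  (* a price above 1 / alpha makes the dual value at most sum ptilde - 1 *)
  have vle : \sum_m p m * pen_length l (pitilde X alpha z m) <= 1.
    rewrite -p1; apply: ler_sum => m _.
    have /andP[_ v1] := pen_length_bounds (pitilde X alpha z m) l0.
    by rewrite ler_piMr//; case/andP: (pm01 m).
  apply: le_trans (leeDr _ L_ge0); rewrite lee_fin; lra.
have hv := sum_pen_length_error n2 M1 alpha01 pm01 pim01 l0 la good.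
have he := expectation_pen_length_cells X reg a0 l0 la.
apply: le_trans (leeD (optimal_length_dual reg alpha l0) (lexx _)).
rewrite -EFinD lee_fin.
have : \sum_m p m * (pen_length l (pitilde X alpha z m) - pen_length l (pi m)) =
   \sum_m p m * pen_length l (pitilde X alpha z m) - \sum_m p m * pen_length l (pi m).
  by rewrite -sumrB; apply: eq_bigr => m _; rewrite mulrBr.
lra.
Qed.

Lemma bounded_level z :
  bounded_mfun (fun x => f_ta (pitilde X alpha z (cell_index X x))
    (atilde z (cell_index X x)) (piP x)).
Proof.
have [pi01 _] := reg; have pt := pitilde_bounds X n2 M1 alpha01 z.
apply: bounded_mfun01 => [|x]; last by apply: f_ta_ge0_le1 => //; exact: atilde_bounds.
apply: measurable_f_ta; last exact: measurable_funP.
- by have [] := bounded_cell_fun X (fun m => pitilde X alpha z m).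
- by have [] := bounded_cell_fun X (fun m => atilde z m).
Qed.

(** Averaging the affine minorant over a cell gives coverage at least
    [1 - atilde z m] there, since [pitilde] lies between the cell mean and 1/2.
    The total miscoverage [q] then satisfies [q + L / n * q <= alpha]: the slack
    of [ptilde] contributes [L / n] times the sum of the [atilde z m], and that
    sum is at least [q]. *)
Lemma good_coverage z :
  (forall m, [/\ good_mass X alpha p z m, good_lower X alpha pi z m true &
      good_lower X alpha pi z m false]) ->
  1 - alpha * n%:R / (n%:R + L) <=
  \int[PX]_x f_ta (pitilde X alpha z (cell_index X x)) (atilde z (cell_index X x)) (piP x).
Proof.
move=> good; have [a0 a1] := andP alpha01; have [pi01 _] := reg.
have n0 := @n_gt0 R n n2; have L1 := lg_ge1 n2 M1 alpha01.
have pt := pitilde_bounds X n2 M1 alpha01 z; have at01 := atilde_bounds z.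
have pm01 := cell_prob_bounds X P; have pim01 := cell_mean_bounds X reg.
have spend : \sum_m p m * atilde z m <= alpha * n%:R / (n%:R + L).
  set s := \sum_m atilde z m.
  have h1 : \sum_m p m * atilde z m <= s.
    by apply: ler_sum => m _; rewrite ler_piMl//; [case/andP: (at01 m)|case/andP: (pm01 m)].
  have h2 : \sum_m p m * atilde z m + L / n%:R * s <= alpha.
    have [h _] := argmin; have [[_ hf] _] := h z; apply: le_trans hf.
    rewrite /s mulr_sumr -big_split /=; apply: ler_sum => m _.
    rewrite -mulrDl; apply: ler_wpM2r; first by case/andP: (at01 m).
    by apply: good_mass_ptilde => //; case: (good m).
  have Ln : 0 <= L / n%:R by rewrite divr_ge0//; lra.
  rewrite ler_pdivlMr; last lra.
  have := ler_wpM2l Ln h1.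
  set q := \sum_m p m * atilde z m in h2 * => h3.
  have -> : q * (n%:R + L) = (q + L / n%:R * q) * n%:R by field; lra.
  apply: ler_wpM2r; lra.
(* the coefficients of the affine minorants, one pair for each cell *)
have /choice[ce ceP] : forall m, exists ce : R * R,
    [/\ forall s, ce.1 + ce.2 * s <= f_ta (pitilde X alpha z m) (atilde z m) s &
        1 - atilde z m <= ce.1 + ce.2 * pi m].
  move=> m; have [c [e [ceq cet e1 e2]]] := f_ta_minorant (pt m) (at01 m).
  exists (c, e); split=> //=; rewrite -cet lerD2l.
  have [_ g1 g0] := good m.
  have [[th pile]|[[th tlpi]|th]] := pitilde_side n2 M1 alpha01 pim01 g1 g0.
  - by apply: ler_wnM2l => //; exact: e1.
  - by apply: ler_wpM2l => //; exact: e2.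
  - have e00 : e = 0.
      by apply/eqP; rewrite eq_le e1 ?e2// th.
    by rewrite e00 !mul0r.
have bf := bounded_level z.
have bp := bounded_piP reg.
have b1 := bounded_cell_fun X (fun m => (ce m).1).
have b2 : bounded_mfun (fun x => (ce (cell_index X x)).2 * piP x).
  by apply: bounded_mfunM => //; exact: (bounded_cell_fun X (fun m => (ce m).2)).
apply: (@le_trans _ _ (\int[PX]_x ((ce (cell_index X x)).1 +
    (ce (cell_index X x)).2 * piP x))); last first.
  apply: le_expectation => //; first exact: bounded_mfunD.
  by move=> x; have [] := ceP (cell_index X x).
rewrite RintegralD//; [|exact: bounded_integrable..].
rewrite (expectation_cell_cst X P (fun m => (ce m).1)).
rewrite (expectation_cells X P (fun m => (ce m).2))//.
under [X in _ <= _ + X]eq_bigr do rewrite cell_integral//.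
rewrite -big_split /=.
apply: (@le_trans _ _ (\sum_m p m * (1 - atilde z m))).
  have -> : \sum_m p m * (1 - atilde z m) = 1 - \sum_m p m * atilde z m.
    rewrite -[X in X - _](sum_cell_prob X P) -sumrB.
    by apply: eq_bigr => m _; ring.
  lra.
apply: ler_sum => m _; have [_ h] := ceP m; have /andP[pm0 _] := pm01 m.
by have := ler_wpM2l pm0 h; lra.
Qed.

End guarantees.

(** * Guarantees in expectation over the sample *)

Section sample_guarantees.
Context {R : realType} {d M n : nat}.
Variables (X : mpartition R d M) (alpha : R).
Hypotheses (n2 : (2 <= n)%N) (M1 : (1 <= M)%N) (alpha01 : 0 < alpha <= 1).
Variable atilde : n.-tuple (datapt R d) -> 'I_M -> R.
Hypothesis argmin : argmin_rule X alpha atilde.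
Variables (P : probability (datapt R d) R) (piP : {mfun Rvec R d >-> R}).
Hypothesis reg : is_regression P piP.
Variables (dO : measure_display) (O : measurableType dO) (Pr : probability O R)
  (Z : 'I_n.+1 -> {RV Pr >-> datapt R d}) (U : {RV Pr >-> measurableTypeR R}).
Hypothesis iid : iid_sample (unif01 R) P Z U.

Local Notation L := (lg (M := M) (n := n) alpha).
Local Notation p := (cell_prob X P).
Local Notation pi := (cell_mean X P piP).
Local Notation PX := (marginalX P).
Local Notation y := (M%:R * (L / (alpha * n%:R))).
Implicit Types z : n.-tuple (datapt R d).

Let nu : probability (n.-tuple (datapt R d)) R := distribution Pr (train_rv Z).

Let nu_box (A : 'I_n -> set (datapt R d)) : (forall i, measurable (A i)) ->
  nu (box A) = (\prod_(i < n) P (A i))%E.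
Proof. exact: (training_box iid). Qed.

Let pt z m := pitilde_bounds X n2 M1 alpha01 z m.
Let at01 z m := atilde_bounds argmin z m.

Let event := [set w | piP (testX (fun i w => Z i w) w) \in
  Chat X alpha atilde (training (fun i w => Z i w) w) (U w) (testX (fun i w => Z i w) w)].

Let sample_event : set (n.-tuple (datapt R d) * (d.-tuple R * measurableTypeR R)) :=
  [set v | Chat X alpha atilde v.1 v.2.2 v.2.1 (piP v.2.1)].

Let measurable_sample_event : measurable sample_event.
Proof.
have [_ ma] := argmin; apply: measurable_Chat => //.
- exact: measurableT_comp measurable_snd.
- exact: measurableT_comp measurable_snd.
- by apply: measurableT_comp => //; exact: measurableT_comp measurable_snd.
Qed.

Let eventE : event = sample_RV Z U @^-1` sample_event.
Proof. by apply/seteqP; split=> w; [move=> /set_mem|move=> ?; apply/mem_set]. Qed.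

Lemma measurable_coverage_event : measurable event.
Proof.
rewrite eventE -[X in measurable X]setTI.
by apply: (measurable_funP (sample_RV Z U)).
Qed.

Lemma coverage_event_prob :
  Pr event = (\int[nu]_z (\int[PX]_x
    (f_ta (pitilde X alpha z (cell_index X x)) (atilde z (cell_index X x)) (piP x))%:E))%E.
Proof.
have [pi01 _] := reg.
have -> : Pr event = (\int[Pr]_w (\1_sample_event (sample_rv Z U w))%:E)%E.
  transitivity (\int[Pr]_w (\1_event w)%:E)%E.
    by rewrite integral_indic ?setIT//; exact: measurable_coverage_event.
  by rewrite eventE.
rewrite (sample_integral iid (h := fun v => (\1_sample_event v)%:E)); last 2 first.
- by apply/measurable_EFinP; exact: measurable_indic.
- by move=> v; rewrite lee_fin.
apply: eq_integral => z _.
apply: eq_integral => x _.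
rewrite -(coverage_prob X (pt z) (at01 z))//.
rewrite (_ : (fun v => _) = EFin \o \1_([set u | Chat X alpha atilde z u x (piP x)])) //.
rewrite integral_indic ?setIT//.
by apply: measurable_C_ta => //.
Qed.

(** A sample that is not good, of probability at most [3 * alpha / (4 * n)], may
    lose all of its coverage; the good ones leave [alpha * L / (n + L)] of the
    budget unspent, which is more. *)
Lemma coverage_guarantee : ((1 - alpha)%:E <= Pr event)%E.
Proof.
have [a0 a1] := andP alpha01.
have n0 := @n_gt0 R n n2; have Lg := lg_ge n2 M1 alpha01.
rewrite coverage_event_prob.
pose B := coverage_failures X alpha P piP (n := n).
have mB : measurable B by exact: measurable_failures.
have nB := coverage_failures_prob X n2 M1 alpha01 reg nu_box; rewrite -/B in nB.
pose K := 1 - alpha * n%:R / (n%:R + L).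
have K0 : 0 <= K.
  by rewrite subr_ge0 ler_pdivrMr; [nra|lra].
have K1 : K <= 1 by rewrite lerBlDr lerDl divr_ge0 ?mulr_ge0; lra.
have nuE : (nu (~` B) = 1 - nu B)%E by exact: probability_setC.
have fB : (nu B = (fine (nu B))%:E)%E by rewrite fineK// fin_num_measure.
have b0 : 0 <= fine (nu B) by rewrite fine_ge0.
move: nB; rewrite [X in (X <= _)%E]fB lee_fin => nB.
have mi : measurable_fun setT (fun z => (\1_(~` B) z)%:E : \bar R).
  by apply/measurable_EFinP; apply: measurable_indic; exact: measurableC.
apply: (@le_trans _ _ (\int[nu]_z (K%:E * (\1_(~` B) z)%:E))%E).
  rewrite ge0_integralZl//.
  rewrite integral_indic ?setIT//; last exact: measurableC.
  rewrite [X in (_ <= _ * X)%E]nuE [X in (_ <= _ * (_ - X))%E]fB -EFinB -EFinM lee_fin.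
  have kb : K * fine (nu B) <= fine (nu B) by rewrite ler_piMl.
  have : alpha * n%:R / (n%:R + L) + 3 * alpha / (4 * n%:R) <= alpha.
    rewrite -lerBrDl.
    have -> : alpha - alpha * n%:R / (n%:R + L) = alpha * L / (n%:R + L) by field; lra.
    rewrite ler_pdivrMr; last lra.
    rewrite mulrAC ler_pdivlMr; last lra.
    have n1 : 2 <= n%:R :> R by rewrite ler_nat.
    have : 3 * (n%:R + L) <= L * (4 * n%:R) by nra.
    move=> /(ler_wpM2l (ltW a0)); lra.
  rewrite /K; rewrite /K in kb; lra.
have [pi01 _] := reg; have [_ ma] := argmin.
have mpi : measurable_fun setT piP by exact: measurable_funP.
pose F (v : n.-tuple (datapt R d) * d.-tuple R) : \bar R :=
  (f_ta (pitilde X alpha v.1 (cell_index X v.2)) (atilde v.1 (cell_index X v.2)) (piP v.2))%:E.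
have mF : measurable_fun setT F.
  apply/measurable_EFinP; apply: measurable_f_ta; last exact: measurableT_comp.
  - apply: (@measurable_cell_fun _ _ _ X _ _ (fun m v => pitilde X alpha v.1 m)) => // m.
    exact: (measurableT_comp (measurable_pitilde X alpha m)).
  - apply: (@measurable_cell_fun _ _ _ X _ _ (fun m v => atilde v.1 m)) => // m.
    exact: (measurableT_comp (ma m)).
have F0 v : (0 <= F v)%E.
  rewrite lee_fin.
  have := f_ta_ge0_le1 (pt v.1 (cell_index X v.2))
    (at01 v.1 (cell_index X v.2)) (pi01 v.2).
  by case/andP.
apply: ge0_le_integral => //.
- by move=> z _; rewrite mule_ge0// lee_fin.
- exact: emeasurable_funM.
- exact: (measurable_fun_fubini_tonelli_F F mF F0).
move=> z _; rewrite indicE; have [zB|zB] := boolP (z \in ~` B); last first.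
  by rewrite mule0; apply: integral_ge0 => x _; exact: (F0 (z, x)).
rewrite mule1 EFin_expectation ?lee_fin//; last first.
  exact: (bounded_level n2 M1 alpha01 argmin reg z).
apply: good_coverage => //; apply: coverage_goodP.
by move: zB => /set_mem.
Qed.

Let lengths : set ((n.-tuple (datapt R d) * (d.-tuple R * measurableTypeR R)) * R) :=
  [set v | Chat X alpha atilde v.1.1 v.1.2.2 v.1.2.1 v.2].

Lemma expected_length_given_sample :
  (\int[Pr]_w lebesgue_measure
      (Chat X alpha atilde (training (fun i w => Z i w) w) (U w)
        (testX (fun i w => Z i w) w)) =
   \int[nu]_z (\sum_m ell (pitilde X alpha z m) (atilde z m) * p m)%:E)%E.
Proof.
have [_ ma] := argmin.
have mlen : measurable lengths.
  pose T := ((n.-tuple (datapt R d) * (d.-tuple R * measurableTypeR R)) * R)%type.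
  have m12 : measurable_fun setT (fun v : T => v.1.2).
    exact: (measurableT_comp measurable_snd measurable_fst).
  apply: measurable_Chat => //.
  - exact: (measurableT_comp measurable_fst measurable_fst).
  - exact: (measurableT_comp measurable_fst m12).
  - exact: (measurableT_comp measurable_snd m12).
pose h (v : n.-tuple (datapt R d) * (d.-tuple R * measurableTypeR R)) : \bar R :=
  (@lebesgue_measure R) (xsection lengths v).
have mh : measurable_fun setT h by exact: (measurable_fun_xsection (@lebesgue_measure R) mlen).
have hE z x u : h (z, (x, u)) = lebesgue_measure (C_ta X (pitilde X alpha z) (atilde z) u x).
  rewrite /h; congr (lebesgue_measure _).
  by apply/seteqP; split=> s; rewrite /xsection /= inE.
transitivity (\int[Pr]_w h (sample_rv Z U w))%E.
  by apply: eq_integral => w _; rewrite hE.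
rewrite (sample_integral iid)//.
apply: eq_integral => z _.
rewrite -(expectation_cell_cst X P (fun m => ell (pitilde X alpha z m) (atilde z m))).
rewrite -EFin_expectation//; last first.
  exact: (bounded_cell_fun X (fun m => ell (pitilde X alpha z m) (atilde z m))).
apply: eq_integral => x _; under eq_integral do rewrite hE.
exact: (expected_length X (pt z) (at01 z)).
Qed.

Lemma length_given_sample_bounds z :
  0 <= \sum_m ell (pitilde X alpha z m) (atilde z m) * p m <= 1.
Proof.
have pm01 := cell_prob_bounds X P.
have pt' m : 0 <= pitilde X alpha z m <= 1 by have := pt z m; lra.
apply/andP; split.
  apply: sumr_ge0 => m _; apply: mulr_ge0; last by case/andP: (pm01 m).
  by case/andP: (ell_bounds (pt' m) (at01 z m)).
rewrite -(sum_cell_prob X P); apply: ler_sum => m _.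
rewrite ler_piMl//; first by case/andP: (pm01 m).
by case/andP: (ell_bounds (pt' m) (at01 z m)).
Qed.

Lemma measurable_length_given_sample :
  measurable_fun setT (fun z => \sum_m ell (pitilde X alpha z m) (atilde z m) * p m).
Proof.
have [_ ma] := argmin; apply: measurable_sum => m; apply: measurable_funM => //.
by apply: measurable_ell; [exact: measurable_pitilde|exact: ma].
Qed.

Lemma expected_length_le1 :
  (\int[Pr]_w lebesgue_measure
      (Chat X alpha atilde (training (fun i w => Z i w) w) (U w)
        (testX (fun i w => Z i w) w)) <= 1)%E.
Proof.
rewrite expected_length_given_sample.
have -> : (1 = \int[nu]_z 1%:E :> \bar R)%E.
  by rewrite integral_cst//= mul1e [RHS](@probability_setT _ _ _ nu).
apply: ge0_le_integral => //.
- by move=> z _; rewrite lee_fin; case/andP: (length_given_sample_bounds z).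
- by apply/measurable_EFinP; exact: measurable_length_given_sample.
- by move=> z _; rewrite lee_fin; case/andP: (length_given_sample_bounds z).
Qed.

(** On good samples the error is at most [14 * Num.sqrt y + 6 * y], and the
    others have probability at most [5 / 4 * y]; if [y] exceeds 1, the bound
    exceeds the length 1 of the unit interval. *)
Lemma length_bound_by_log :
  (\int[Pr]_w lebesgue_measure
      (Chat X alpha atilde (training (fun i w => Z i w) w) (U w)
        (testX (fun i w => Z i w) w)) <=
   optimal_length alpha (distribution PX piP) +
   (Num.sqrt (2 * blur X P piP / alpha) + 22 * Num.sqrt y)%:E)%E.
Proof.
have [a0 a1] := andP alpha01; have [_ ma] := argmin.
have n0 := @n_gt0 R n n2; have L1 := lg_ge1 n2 M1 alpha01.
have an0 : 0 < alpha * n%:R by rewrite mulr_gt0.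
have y_ge : alpha / n%:R <= y.
  have M1R : 1 <= M%:R :> R by rewrite ler1n.
  have -> : y = M%:R * L / alpha / n%:R by field; lra.
  apply: ler_wpM2r; first by rewrite invr_ge0 ltW.
  rewrite ler_pdivlMr//; nra.
have y0 : 0 <= y by apply: le_trans y_ge; rewrite divr_ge0// ltW.
have sb := sqrtr_ge0 (2 * blur X P piP / alpha).
have L_ge0 := optimal_length_ge0 P piP alpha.
pose psi z := \sum_m ell (pitilde X alpha z m) (atilde z m) * p m.
have mpsi : measurable_fun setT psi := measurable_length_given_sample.
have psi01 z : 0 <= psi z <= 1 by exact: length_given_sample_bounds.
have [y1|y1] := leP 1 y.
  apply: (@le_trans _ _ 1%E); first exact: expected_length_le1.
  apply: le_trans (leeDr _ L_ge0); rewrite lee_fin.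
  have : 1 <= Num.sqrt y by apply: sqr_le_sqrt => //; rewrite expr1n.
  lra.
rewrite expected_length_given_sample.
have ysq : y <= Num.sqrt y.
  by apply: sqr_le_sqrt => //; rewrite expr2 ler_piMl// ltW.
have [Loo|Lfin] := eqVneq (optimal_length alpha (distribution PX piP)) +oo%E.
  by rewrite Loo addye// leey.
have LE : optimal_length alpha (distribution PX piP) =
    (fine (optimal_length alpha (distribution PX piP)))%:E.
  by rewrite fineK// ge0_fin_numE// ltey.
have goodlen z := @good_length _ _ _ _ X alpha n2 M1 alpha01 atilde argmin P piP reg z.
rewrite LE in L_ge0 goodlen *; move: (fine _) => l in L_ge0 goodlen *.
pose B := length_failures X alpha P piP (n := n).
have mB : measurable B by exact: measurable_failures.
have nB := length_failures_prob X n2 M1 alpha01 reg nu_box; rewrite -/B in nB.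
pose k := l + (Num.sqrt (2 * blur X P piP / alpha) + (14 * Num.sqrt y + 6 * y)).
have k0 : 0 <= k.
  have sy := sqrtr_ge0 y; rewrite lee_fin in L_ge0.
  by rewrite /k; lra.
apply: (@le_trans _ _ (\int[nu]_z (k%:E + (\1_B z)%:E))%E).
  apply: ge0_le_integral => //.
  - by move=> z _; rewrite lee_fin; case/andP: (psi01 z).
  - exact/measurable_EFinP.
  - by apply: emeasurable_funD => //; apply/measurable_EFinP; exact: measurable_indic.
  move=> z _; rewrite indicE -EFinD; have [zB|zB] := boolP (z \in B).
    by rewrite lee_fin; case/andP: (psi01 z) => _ h; apply: (le_trans h); rewrite lerDr.
  rewrite addr0 /k EFinD; apply: goodlen; apply: length_goodP.
  by move: zB; rewrite notin_setE.
have mI : measurable_fun setT (fun z => (\1_B z)%:E : \bar R).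
  by apply/measurable_EFinP; exact: measurable_indic.
rewrite ge0_integralD//.
rewrite integral_cst// integral_indic// setIT.
rewrite [X in (_ * X + _)%E](@probability_setT _ _ _ nu) mule1.
apply: (le_trans (leeD (lexx _) nB)).
rewrite -!EFinD lee_fin /k.
have -> : 5 * alpha / (4 * n%:R) = 5 / 4 * (alpha / n%:R) by field; lra.
lra.
Qed.

(** If [M <= alpha * n] then [4 * M * n / alpha <= n ^ 4], so that
    [L <= 4 * ln n] and [44 = 2 * 22]. *)
Lemma length_guarantee :
  (\int[Pr]_w lebesgue_measure
      (Chat X alpha atilde (training (fun i w => Z i w) w) (U w)
        (testX (fun i w => Z i w) w)) <=
   optimal_length alpha (distribution PX piP) +
   (Num.sqrt (2 * blur X P piP / alpha) +
    44 * Num.sqrt (M%:R * ln n%:R / (alpha * n%:R)))%:E)%E.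
Proof.
have [a0 a1] := andP alpha01.
have n0 := @n_gt0 R n n2; have L1 := lg_ge1 n2 M1 alpha01.
have an0 : 0 < alpha * n%:R by rewrite mulr_gt0.
have n2R : 2 <= n%:R :> R by rewrite ler_nat.
have M0 : 0 < M%:R :> R by rewrite ltr0n.
have lnn : 1 / 2 <= ln n%:R :> R.
  by apply: le_trans (ln2_ge) _; rewrite ler_ln ?posrE.
set w := M%:R * ln n%:R / (alpha * n%:R).
have sw := sqrtr_ge0 w.
have sb := sqrtr_ge0 (2 * blur X P piP / alpha).
have [Man|Man] := leP M%:R (alpha * n%:R); last first.
  (* here the error term exceeds 1, which bounds every length *)
  have w1 : 1 / 2 <= w.
    rewrite ler_pdivlMr//; nra.
  have sw1 : 1 / 2 <= Num.sqrt w.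
    apply: sqr_le_sqrt; first by rewrite divr_ge0.
    by apply: le_trans w1; rewrite expr2 ger_pMl; lra.
  apply: (@le_trans _ _ 1%E); first exact: expected_length_le1.
  by apply: le_trans (leeDr _ (optimal_length_ge0 P piP alpha)); rewrite lee_fin; lra.
apply: (le_trans length_bound_by_log).
apply: leeD => //; rewrite lee_fin lerD2l.
have q0 : 0 < (4 * M * n)%:R / alpha :> R.
  by rewrite divr_gt0// ltr0n !muln_gt0 M1 (leq_trans _ n2).
have L4 : L <= 4 * ln n%:R.
  have -> : 4 * ln n%:R = ln (n%:R ^+ 4) :> R by rewrite lnXn// mulr_natl.
  rewrite /lg ler_ln ?posrE ?exprn_gt0// ler_pdivrMr//.
  rewrite !natrM.
  have -> : n%:R ^+ 4 * alpha = n%:R ^+ 2 * ((alpha * n%:R) * n%:R) :> R by ring.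
  have n4 : 4 <= n%:R ^+ 2 :> R by rewrite expr2; nra.
  have Mn : M%:R * n%:R <= alpha * n%:R * n%:R :> R.
    by apply: ler_wpM2r => //; exact: ltW.
  have Mn0 : 0 <= M%:R * n%:R :> R by apply: mulr_ge0; exact: ltW.
  by rewrite -mulrA; exact: ler_pM.
have : Num.sqrt y <= 2 * Num.sqrt w.
  have w0 : 0 <= w.
    by apply: divr_ge0; [apply: mulr_ge0; lra|exact: ltW].
  apply: sqrt_le_sqr; first by rewrite mulr_ge0.
  rewrite exprMn sqr_sqrtr// /w.
  have -> : 2 ^+ 2 * (M%:R * ln n%:R / (alpha * n%:R)) =
     M%:R * (4 * ln n%:R / (alpha * n%:R)) :> R by ring.
  apply: ler_wpM2l; first exact: ltW.
  by apply: ler_wpM2r => //; rewrite invr_ge0 ltW.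
lra.
Qed.

End sample_guarantees.

Theorem theorem3 (R : realType) :
  exists c : R,
  forall (n d M : nat) (alpha : R),
    (2 <= n)%N -> (1 <= d)%N -> (1 <= M)%N -> 0 < alpha <= 1 ->
  forall (X : mpartition R d M) (atilde : n.-tuple (datapt R d) -> 'I_M -> R),
    argmin_rule X alpha atilde ->
  distribution_free_ci (unif01 R) (Chat X alpha atilde) alpha /\
  forall (P : probability (datapt R d) R) (piP : {mfun Rvec R d >-> R}),
    is_regression P piP ->
  forall (dO : measure_display) (O : measurableType dO) (Pr : probability O R)
      (Z : 'I_n.+1 -> {RV Pr >-> datapt R d}) (U : {RV Pr >-> measurableTypeR R}),
    iid_sample (unif01 R) P Z U ->
  (\int[Pr]_w lebesgue_measure
      (Chat X alpha atilde (training Z w) (U w) (testX Z w)) <=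
   optimal_length alpha (distribution (marginalX P) piP) +
   (Num.sqrt (2 * blur X P piP / alpha) +
    c * Num.sqrt (M%:R * ln n%:R / (alpha * n%:R)))%:E)%E.
Proof.
exists 44 => n d M alpha n2 _ M1 alpha01 X atilde argmin; split.
  move=> P piP reg dO O Pr Z U iid; split.
    exact: (measurable_coverage_event argmin piP Z U).
  exact: (coverage_guarantee n2 M1 alpha01 argmin reg iid).
by move=> P piP reg dO O Pr Z U iid; exact: (length_guarantee n2 M1 alpha01 argmin reg iid).
Qed.
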